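(* Let $A\in\mathbb{M}(3,\mathbb{F}_q)$ and suppose that either $A$ is a scalar matrix or the plane filling curve $C_A$ is reducible over $\mathbb{F}_q$. Let $f_A(t)=\det(tE-A)$ be the characteristic polynomial of $A$. (i) (Case 1) If $f_A(t)=(t-\alpha)g(t)$ with $\alpha\in\mathbb{F}_q$ and $g(t)\in\mathbb{F}_q[t]$ a monic quadratic polynomial irreducible over $\mathbb{F}_q$, then $C_A$ splits into an $\mathbb{F}_q$-line and an irreducible curve $C_A'$ of degree $q+1$, and $C_A'$ is a curve of type (T1). (ii) (Case 2) If $f_A(t)=(t-\alpha_1)(t-\alpha_2)(t-\alpha_3)$ with $\alpha_1,\alpha_2,\alpha_3\in\mathbb{F}_q$ pairwise distinct, then $C_A$ splits into three $\mathbb{F}_q$-lines and an irreducible curve $C_A'$ of degree $q-1$. The three lines are not concurrent, and $C_A'$ is a curve of type (T2). (iii) (Case 3.1) If $f_A(t)=(t-\alpha)^2(t-\beta)$ with $\alpha,\beta\in\mathbb{F}_q$, $\alpha\neq\beta$, and the minimal polynomial of $A$ is $f_A(t)$, then $C_A$ splits into two $\mathbb{F}_q$-lines and an irreducible curve $C_A'$ of degree $q$, and $C_A'$ is a curve of type (T3). (iv) (Case 3.2) If $f_A(t)=(t-\alpha)^2(t-\beta)$ with $\alpha,\beta\in\mathbb{F}_q$, $\alpha\neq\beta$, and the minimal polynomial of $A$ is $(t-\alpha)(t-\beta)$, then $C_A$ splits into $q+2$ $\mathbb{F}_q$-lines. Among them, $q+1$ lines pass through a common point, and the remaining one does not. (v)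 (Case 4.1) If $f_A(t)=(t-\alpha)^3$ with $\alpha\in\mathbb{F}_q$ and the minimal polynomial of $A$ is $f_A(t)$, then $C_A$ splits into an $\mathbb{F}_q$-line and an irreducible curve $C_A'$ of degree $q+1$, and $C_A'$ is a curve of type (T4). (vi) (Case 4.2) If $f_A(t)=(t-\alpha)^3$ with $\alpha\in\mathbb{F}_q$ and the minimal polynomial of $A$ is $(t-\alpha)^2$, then $C_A$ splits into $q$ reduced $\mathbb{F}_q$-lines and one double line over $\mathbb{F}_q$, and all of these lines (including the double line) pass through a common point. (vii) (Case 4.3) If $f_A(t)=(t-\alpha)^3$ with $\alpha\in\mathbb{F}_q$ and the minimal polynomial of $A$ is $t-\alpha$, then $F_A$ is the zero polynomial.
   Context: $\mathbb{F}_q$ is a finite field with $q$ elements, $\mathbb{M}(3,\mathbb{F}_q)$ is the set of $3\times3$ matrices over $\mathbb{F}_q$, $E$ is the identity matrix, and $\mathbb{P}^2$ is the projective plane with homogeneous coordinates $x,y,z$. Put $U=y^qz-yz^q$, $V=z^qx-zx^q$, $W=x^qy-xy^q$. For $A\in\mathbb{M}(3,\mathbb{F}_q)$ let $$F_A(x,y,z)=(x,y,z)\,A\begin{pmatrix}U\\ V\\ W\end{pmatrix}.$$ It is known that $F_A=0$ as a polynomial if and only if $A=\mu E$ for some $\mu\in\mathbb{F}_q$. For non-scalar $A$, $C_A$ denotes the plane curve of degree $q+2$ defined by $F_A=0$; it is a plane filling curve, i.e. it passes through all $\mathbb{F}_q$-points of $\mathbb{P}^2$. ''Splits into'' refers to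 the factorization of $F_A$ into irreducible factors, with multiplicity. An $\mathbb{F}_q$-line is a line of $\mathbb{P}^2$ defined over $\mathbb{F}_q$. Two curves over $\mathbb{F}_q$ are projectively equivalent over $\mathbb{F}_q$ if a projective transformation given by a matrix in $GL(3,\mathbb{F}_q)$ carries one to the other. Types of curves (each up to projective equivalence over $\mathbb{F}_q$): (T1) the curves of degree $q+1$ projectively equivalent over $\mathbb{F}_q$ to a curve $$(x^q-xz^{q-1},\,y^q-yz^{q-1})\begin{pmatrix}a_0&a_1&a_2\\ b_0&b_1&b_2\end{pmatrix}\begin{pmatrix}x\\ y\\ z\end{pmatrix}=0,$$ where $a_0,\dots,b_2\in\mathbb{F}_q$ and the polynomial $(s,t)\begin{pmatrix}a_0&a_1\\ b_0&b_1\end{pmatrix}\begin{pmatrix}s\\ t\end{pmatrix}$ in $s,t$ is irreducible over $\mathbb{F}_q$; (T2) the curves of degree $q-1$ projectively equivalent over $\mathbb{F}_q$ to a curve $\alpha x^{q-1}+\beta y^{q-1}+\gamma z^{q-1}=0$ with $\alpha,\beta,\gamma\in\mathbb{F}_q$, $\alpha\beta\gamma\neq0$ and $\alpha+\beta+\gamma=0$; (T3) the curves of degree $q$ projectively equivalent over $\mathbb{F}_q$ to $x^q-xz^{q-1}+x^{q-1}y-y^q=0$; (T4) the curves of degree $q+1$ projectively equivalent over $\mathbb{F}_q$ to $x^{q+1}-x^2z^{q-1}+y^qz-yz^q=0$. *)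

(* Defs.v *)
From mathcomp Require Import all_boot all_order all_fingroup all_algebra.
From mathcomp Require Import mpoly.

Set Implicit Arguments.
Unset Strict Implicit.
Unset Printing Implicit Defensive.

Import GRing.Theory.
Local Open Scope ring_scope.

(* Plane curves over F are given by their defining forms, elements of
   {mpoly F[3]}, taken up to a nonzero scalar factor (same_curve below).
   The ground field F is finite and q is #|F|. *)

Definition Xx (F : finFieldType) : {mpoly F[3]} := 'X_(@Ordinal 3 0 isT).
Definition Xy (F : finFieldType) : {mpoly F[3]} := 'X_(@Ordinal 3 1 isT).
Definition Xz (F : finFieldType) : {mpoly F[3]} := 'X_(@Ordinal 3 2 isT).

Definition polyvec (R : nzRingType) (n m : nat) (s : seq {mpoly R[n]}) :
    'cV[{mpoly R[n]}]_m :=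
  \col_(i < m) s`_i.

Definition bilin (R : nzRingType) (n m p : nat) (u : 'cV[{mpoly R[n]}]_m)
    (B : 'M[R]_(m, p)) (v : 'cV[{mpoly R[n]}]_p) : {mpoly R[n]} :=
  (u^T *m map_mx (@mpolyC n R) B *m v) 0 0.

Definition fillU (F : finFieldType) : {mpoly F[3]} :=
  Xy F ^+ #|F| * Xz F - Xy F * Xz F ^+ #|F|.
Definition fillV (F : finFieldType) : {mpoly F[3]} :=
  Xz F ^+ #|F| * Xx F - Xz F * Xx F ^+ #|F|.
Definition fillW (F : finFieldType) : {mpoly F[3]} :=
  Xx F ^+ #|F| * Xy F - Xx F * Xy F ^+ #|F|.

Definition fillF (F : finFieldType) (A : 'M[F]_3) : {mpoly F[3]} :=
  bilin (polyvec 3 [:: Xx F; Xy F; Xz F]) A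
        (polyvec 3 [:: fillU F; fillV F; fillW F]).

(* Irreducibility is over the coefficient field, not its algebraic closure. *)
Definition mirreducible (F : fieldType) (n : nat) (p : {mpoly F[n]}) : Prop :=
  [/\ p != 0, p \isn't a GRing.unit
    & forall g h : {mpoly F[n]}, p = g * h ->
        g \is a GRing.unit \/ h \is a GRing.unit].

Definition mreducible (F : fieldType) (n : nat) (p : {mpoly F[n]}) : Prop :=
  p != 0 /\
  exists g h : {mpoly F[n]},
    [/\ p = g * h, g \isn't a GRing.unit & h \isn't a GRing.unit].

(* The condition p != 0 is needed: 0 is d.-homog for every d. *)
Definition plane_curve (F : finFieldType) (d : nat) (p : {mpoly F[3]}) : bool :=
  (p != 0) && (p \is d.-homog).

Definition line (F : finFieldType) (l : {mpoly F[3]}) : bool :=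
  plane_curve 1 l.

Definition same_curve (F : finFieldType) (p r : {mpoly F[3]}) : bool :=
  [exists c : F, (c != 0) && (p == c *: r)].

Definition distinct_curves (F : finFieldType) (s : seq {mpoly F[3]}) : bool :=
  pairwise (fun p r => ~~ same_curve p r) s.

(* The components in s are listed with multiplicity. *)
Definition splits_into (F : finFieldType) (p : {mpoly F[3]})
    (s : seq {mpoly F[3]}) : Prop :=
  (forall r, r \in s -> mirreducible r) /\ same_curve p (\prod_(r <- s) r).

(* A point of the projective plane is given by a nonzero P : 'rV[F]_3.
   F-rational points suffice for concurrency: lines with coefficients in F
   that meet over an extension of F also meet in an F-point. *)
Definition passes_through (F : finFieldType) (p : {mpoly F[3]})
    (P : 'rV[F]_3) : bool :=
  p.@[fun i => P 0 i] == 0.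

Definition concurrent (F : finFieldType) (s : seq {mpoly F[3]}) : Prop :=
  exists2 P : 'rV[F]_3, P != 0 & all (fun l => passes_through l P) s.

(* p evaluated at T (x, y, z)^T. *)
Definition lin_subst (F : finFieldType) (T : 'M[F]_3) (p : {mpoly F[3]}) :
    {mpoly F[3]} :=
  p \mPo [tuple \sum_(j < 3) T i j *: 'X_j | i < 3].

Definition proj_equiv (F : finFieldType) (p r : {mpoly F[3]}) : Prop :=
  exists2 T : 'M[F]_3, T \in unitmx & same_curve p (lin_subst T r).

Definition quad_part (F : finFieldType) (B : 'M[F]_(2, 3)) : {mpoly F[2]} :=
  let st := polyvec 2 [:: 'X_(@Ordinal 2 0 isT); 'X_(@Ordinal 2 1 isT)] in
  bilin st (colsub (widen_ord (isT : (2 <= 3)%N)) B) st.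

Definition curve1 (F : finFieldType) (B : 'M[F]_(2, 3)) : {mpoly F[3]} :=
  bilin (polyvec 2 [:: Xx F ^+ #|F| - Xx F * Xz F ^+ #|F|.-1;
                       Xy F ^+ #|F| - Xy F * Xz F ^+ #|F|.-1])
        B (polyvec 3 [:: Xx F; Xy F; Xz F]).

Definition type1 (F : finFieldType) (p : {mpoly F[3]}) : Prop :=
  plane_curve #|F|.+1 p /\
  exists2 B : 'M[F]_(2, 3), mirreducible (quad_part B) & proj_equiv p (curve1 B).

Definition curve2 (F : finFieldType) (a b c : F) : {mpoly F[3]} :=
  a *: Xx F ^+ #|F|.-1 + b *: Xy F ^+ #|F|.-1 + c *: Xz F ^+ #|F|.-1.

Definition type2 (F : finFieldType) (p : {mpoly F[3]}) : Prop :=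
  plane_curve #|F|.-1 p /\
  exists a b c : F,
    [/\ a * b * c != 0, a + b + c = 0 & proj_equiv p (curve2 a b c)].

Definition curve3 (F : finFieldType) : {mpoly F[3]} :=
  Xx F ^+ #|F| - Xx F * Xz F ^+ #|F|.-1 + Xx F ^+ #|F|.-1 * Xy F
    - Xy F ^+ #|F|.

Definition type3 (F : finFieldType) (p : {mpoly F[3]}) : Prop :=
  plane_curve #|F| p /\ proj_equiv p (curve3 F).

Definition curve4 (F : finFieldType) : {mpoly F[3]} :=
  Xx F ^+ #|F|.+1 - Xx F ^+ 2 * Xz F ^+ #|F|.-1 + Xy F ^+ #|F| * Xz F
    - Xy F * Xz F ^+ #|F|.

Definition type4 (F : finFieldType) (p : {mpoly F[3]}) : Prop :=
  plane_curve #|F|.+1 p /\ proj_equiv p (curve4 F).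

(* Main.v *)
Require Import Defs.
From HB Require Import structures.
From mathcomp Require Import all_boot all_order all_fingroup all_algebra.
From mathcomp Require Import all_solvable all_field.
From mathcomp Require Import zify ring.
From mathcomp Require Import mpoly.

Set Implicit Arguments.
Unset Strict Implicit.
Unset Printing Implicit Defensive.

Import GRing.Theory.
Local Open Scope ring_scope.

(** Write X for the row (x, y, z) and X^q for (x^q, y^q, z^q). Since (U, V, W)
    is the cross product of X^q and X, the form F_A is the determinant of the
    rows X A, X^q and X ([fillF_det]). Two facts follow. Subtracting a multiple
    of the last row from the first, F_A depends on A only modulo scalar
    matrices. And as (X T)^q = X^q T for a matrix T over F_q, a linear change of
    coordinates with S (A - a E) = B S turns F_A into F_B up to a nonzero
    scalar ([splits_into_similar]). So it is enough to factor F_B for a normal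
    form B of A - a E, in a basis chosen so that the residual factor is exactly
    the curve of the required type:

    - if the quadratic factor g is irreducible, F_B is z times a curve with a
      node at (0 : 0 : 1) whose tangents are given by the roots of g;
    - if the eigenvalues are distinct, F_B is x y z times a Fermat-like curve
      whose coefficients are the differences of the eigenvalues;
    - Jordan blocks of sizes 2 and 1 give x z times [curve3], and one block of
      size 3 gives z times [curve4];
    - if B = u r has rank one, F_B is the linear form u times the determinant of
      r, X^q, X, which is the product of the q + 1 lines over F_q through the
      point r. The line u misses r when B has a nonzero eigenvalue, and it is
      one of these q + 1 lines when B is nilpotent. Both cases in which the
      minimal polynomial has degree 2 are of this kind.

    The residual curves are irreducible because, possibly after an extension of
    the field, each has a line that meets it in a single point P. All components
    of positive degree pass through P, so two of them would make P singular, which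
    settles the curves that are smooth at P ([total_tangency_irreducible]). For
    the nodal curve P is the node and the line one of the two conjugate tangents;
    two components over F_q would split the quadratic leading term at the node
    into linear forms over F_q, but this term is g made homogeneous, which is
    irreducible ([total_contact_node_irreducible]). *)

(** * Restriction of a form to a line *)

Section Restriction.

Variables (F K : fieldType) (iota : {rmorphism F -> K}) (n : nat).

(** The map t |-> P + t Q parametrizes the line joining P to Q, with P at t = 0.
    The field K is an extension of F because the lines of interest need not be
    defined over F. *)
Definition restr (P Q : 'I_n -> K) : {mpoly F[n]} -> {poly K} :=
  mmap (polyC \o iota) (fun i => (P i)%:P + Q i *: 'X).

HB.instance Definition _ P Q :=
  GRing.RMorphism.copy (restr P Q)
    (mmap (polyC \o iota) (fun i => (P i)%:P + Q i *: 'X)).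

Lemma restrX P Q i : restr P Q 'X_i = (P i)%:P + Q i *: 'X.
Proof. by rewrite /restr mmapX mmap1U. Qed.

Lemma restrC P Q c : restr P Q c%:MP = (iota c)%:P.
Proof. by rewrite /restr mmapC. Qed.

Lemma restrZ P Q c p : restr P Q (c *: p) = iota c *: restr P Q p.
Proof. by rewrite -mul_mpolyC rmorphM /= restrC mul_polyC. Qed.

Lemma size_restr P Q p : (size (restr P Q p) <= msize p)%N.
Proof.
rewrite /restr /mmap msizeE; apply: leq_trans (size_sum _ _ _) _.
apply/bigmax_leqP_seq => m m_in _ /=.
apply: leq_trans (leq_bigmax_seq _ m_in isT).
rewrite mul_polyC; apply: leq_trans (size_scale_leq _ _) _.
rewrite /mmap1; apply: leq_trans (size_prod_leq _ _) _.
rewrite mdegE leq_subLR addnS ltnS -sum1_card -big_split /=; apply: leq_sum => i _.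
apply: leq_trans (size_poly_exp_leq _ _) _.
rewrite add1n ltnS -[X in (_ <= X)%N]mul1n leq_mul2r; apply/orP; right.
have le2 : (size ((P i)%:P + Q i *: 'X)%R <= 2)%N.
  apply: leq_trans (size_polyD _ _) _; rewrite geq_max.
  rewrite (leq_trans (size_polyC_leq1 _)) //.
  by rewrite (leq_trans (size_scale_leq _ _)) // size_polyX.
by case: (size _) le2 => [|[|[]]].
Qed.

(** Statements about ring morphisms out of a polynomial ring, and those that
    follow a Leibniz rule, need to be checked on constants and variables only. *)
Lemma mpoly_ring_ind (S : {mpoly F[n]} -> Prop) :
    (forall c, S c%:MP) -> (forall i, S 'X_i) ->
    (forall p q, S p -> S q -> S (p + q)) ->
    (forall p q, S p -> S q -> S (p * q)) ->
  forall p, S p.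
Proof.
move=> SC SX SD SM p; rewrite [p]mpolyE.
apply: big_ind => // [|m _]; first by rewrite -mpolyC0.
rewrite -mul_mpolyC mpolyXE_id; apply: (SM) => //.
apply: big_ind => // [|i _]; first by rewrite -mpolyC1.
by elim: (m i) => [|k IH]; rewrite ?expr0 -?mpolyC1 // exprS; apply: SM.
Qed.

Lemma restr_coef0 P Q Q' p : (restr P Q p)`_0 = (restr P Q' p)`_0.
Proof.
elim/mpoly_ring_ind: p => [c|i|p q IHp IHq|p q IHp IHq].
- by rewrite !restrC.
- by rewrite !restrX !coefD !coefC !coefZ !coefX !mulr0.
- by rewrite !rmorphD !coefD /= IHp IHq.
- by rewrite !rmorphM /= !coef0M IHp IHq.
Qed.

Lemma coef1M (p q : {poly K}) : (p * q)`_1 = p`_0 * q`_1 + p`_1 * q`_0.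
Proof. by rewrite coefM !big_ord_recl big_ord0 addr0. Qed.

Lemma coef2M (p q : {poly K}) :
  (p * q)`_2 = p`_0 * q`_2 + p`_1 * q`_1 + p`_2 * q`_0.
Proof. by rewrite coefM !big_ord_recl big_ord0 addr0 addrA. Qed.

(** This coefficient is the derivative of p at P in the direction Q, and c is the
    gradient of p at P. *)
Lemma restr_coef1_lin P p :
  exists c : 'I_n -> K, forall Q, (restr P Q p)`_1 = \sum_i Q i * c i.
Proof.
elim/mpoly_ring_ind: p => [c|i|p q [c Hc] [d Hd]|p q [c Hc] [d Hd]].
- exists (fun=> 0) => Q; rewrite restrC coefC /= big1 // => i _.
  by rewrite mulr0.
- exists (fun j => (j == i)%:R) => Q.
  rewrite restrX coefD coefC coefZ coefX /= add0r (bigD1 i) //= eqxx big1.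
    by rewrite addr0.
  by move=> j /negbTE ->; rewrite mulr0.
- exists (fun i => c i + d i) => Q; rewrite rmorphD coefD /= Hc Hd.
  by rewrite -big_split; apply: eq_bigr => i _; rewrite mulrDr.
- pose p0 := (restr P P p)`_0; pose q0 := (restr P P q)`_0.
  exists (fun i => p0 * d i + q0 * c i) => Q.
  rewrite rmorphM /= coef1M Hc Hd (restr_coef0 P Q P p) (restr_coef0 P Q P q).
  rewrite mulr_sumr mulr_suml -big_split; apply: eq_bigr => i _ /=.
  by rewrite -/p0 -/q0; ring.
Qed.

End Restriction.

(** * Irreducibility from total contact with a line *)

Section Irreducibility.

Variables (F : fieldType) (n : nat).
Implicit Types p g h : {mpoly F[n]}.

Lemma msize_mul p q : p != 0 -> q != 0 -> msize (p * q) = (msize p + msize q).-1.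
Proof. exact: msizeM. Qed.

Lemma msize_gt0 p : p != 0 -> (0 < msize p)%N.
Proof. by rewrite lt0n msize_poly_eq0. Qed.

Lemma mpoly_unitE p : (p \is a GRing.unit) = (msize p == 1%N).
Proof.
apply/idP/eqP => [pu|p1].
  have p0 : p != 0 by apply: contraTneq pu => ->; rewrite unitr0.
  case/unitrP: pu => q [qp pq]; have q0 : q != 0.
    by apply/eqP => q0; move/eqP: qp; rewrite q0 mul0r eq_sym oner_eq0.
  have := msize_mul q0 p0; rewrite qp msize1.
  have := msize_gt0 q0; have := msize_gt0 p0; lia.
have := msize1_polyC (eq_leq p1) => pE; rewrite pE.
apply: rmorph_unit; rewrite unitfE; apply/eqP => c0.
by move: p1; rewrite pE c0 mpolyC0 msize0.
Qed.

Lemma mirreducible_msize p :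
  (1 < msize p)%N ->
  (forall g h, p = g * h -> (1 < msize g)%N -> (1 < msize h)%N -> False) ->
  mirreducible p.
Proof.
move=> p1 pgh; split.
- by rewrite -msize_poly_eq0; case: (msize p) p1.
- by rewrite mpoly_unitE; case: (msize p) p1 => [|[]].
move=> g h pE; have p0: p != 0 by rewrite -msize_poly_eq0; case: (msize p) p1.
rewrite !mpoly_unitE.
have: g * h != 0 by rewrite -pE.
rewrite mulf_eq0 negb_or -!msize_poly_eq0 => /andP[g0 h0].
have := pgh _ _ pE.
case: (msize g) g0 => [|[|a]] // _; first by left.
case: (msize h) h0 => [|[|b]] // _ H; first by right.
by case: H.
Qed.

Lemma mirreducible_deg1 p : msize p = 2%N -> mirreducible p.
Proof.
move=> p2; apply: mirreducible_msize => [|g h pE g1 h1]; first by rewrite p2.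
have g0 : g != 0 by rewrite -msize_poly_eq0; case: (msize g) g1.
have h0 : h != 0 by rewrite -msize_poly_eq0; case: (msize h) h1.
by move: p2; rewrite pE msize_mul //; lia.
Qed.

Variables (K : fieldType) (iota : {rmorphism F -> K}).

(** Restriction never raises the degree and degrees are additive on both sides,
    so a restriction that keeps the degree of a product keeps that of each
    factor. *)
Lemma restr_full_degree P Q p g h :
  p = g * h -> p != 0 -> size (restr iota P Q p) = msize p ->
  size (restr iota P Q g) = msize g /\ size (restr iota P Q h) = msize h.
Proof.
move=> pE p0; rewrite pE in p0 *.
move: (p0); rewrite mulf_eq0 negb_or => /andP[g0 h0].
rewrite msize_mul // rmorphM /=.
have sg := size_restr iota P Q g; have sh := size_restr iota P Q h.
have eg := msize_gt0 g0; have eh := msize_gt0 h0.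
have [-> | r0] := eqVneq (restr iota P Q g) 0.
  rewrite mul0r size_poly0. lia.
have [-> | s0] := eqVneq (restr iota P Q h) 0.
  by rewrite mulr0 size_poly0; lia.
move: r0 s0 sg sh; set r := restr _ _ _ g; set s := restr _ _ _ h => r0 s0 sg sh.
have -> : size (r * s) = (size r + size s).-1 by exact: size_mul.
rewrite -size_poly_gt0 in r0; rewrite -size_poly_gt0 in s0.
have tight (a b c d : nat) : (0 < a)%N -> (0 < b)%N -> (a <= c)%N -> (b <= d)%N ->
  (a + b).-1 = (c + d).-1 -> a = c /\ b = d by lia.
exact: tight.
Qed.

(** A factor of p restricts to a divisor of a power of the variable, that is, to a
    monomial; as no degree is lost, this monomial has the degree of the factor
    and vanishes at t = 0. *)
Lemma total_contact_vanish P Q p g h d c :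
  p = g * h -> restr iota P Q p = c *: 'X^d -> c != 0 -> msize p = d.+1 ->
  (1 < msize g)%N -> (restr iota P Q g)`_0 = 0.
Proof.
move=> pE rE c0 sp g1.
have p0 : p != 0 by rewrite -msize_poly_eq0 sp.
have sr : size (restr iota P Q p) = msize p by rewrite rE size_scale // size_polyXn sp.
have [sg _] := restr_full_degree pE p0 sr.
have: restr iota P Q g %| 'X^d.
  by rewrite -(dvdpZr _ _ c0) -rE pE rmorphM dvdp_mulIl.
rewrite -['X]subr0 -polyC0 => /dvdp_exp_XsubCP[k [_ gE]].
move: (gE) => /eqp_size; rewrite sg size_exp_XsubC => gk.
have k0 : (0 < k)%N by rewrite -ltnS -gk.
apply/eqP; rewrite -horner_coef0 -/(root _ _) (eqp_root gE).
by rewrite rootE subr0 hornerXn -(prednK k0) exprS mul0r.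
Qed.

(** A line that meets the curve in P alone forces every component of positive
    degree to pass through P; two of them would make the curve singular there,
    against the nonzero derivative in the direction R. *)
Lemma total_tangency_irreducible P Q R p d c :
  restr iota P Q p = c *: 'X^d -> c != 0 -> msize p = d.+1 -> (0 < d)%N ->
  (restr iota P R p)`_1 != 0 -> mirreducible p.
Proof.
move=> rE c0 sp d0 smooth; apply: mirreducible_msize => [|g h pE g1 h1].
  by rewrite sp.
have gP := total_contact_vanish pE rE c0 sp g1.
have pE' : p = h * g by rewrite mulrC.
have hP := total_contact_vanish pE' rE c0 sp h1.
move/eqP: smooth; apply; rewrite pE rmorphM /= coef1M.
by rewrite !(restr_coef0 _ P R Q) gP hP mul0r mulr0 addr0.
Qed.

End Irreducibility.

Section NodeIrreducibility.

Variables (F K : fieldType) (iota : {rmorphism F -> K}) (n : nat).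
Implicit Types p g h : {mpoly F[n]}.

Lemma restr_coef0_map P Q R p :
  (restr iota (iota \o P) Q p)`_0 = iota (restr idfun P R p)`_0.
Proof.
elim/mpoly_ring_ind: p => [c|i|p q IHp IHq|p q IHp IHq].
- by rewrite !restrC !coefC.
- by rewrite !restrX !coefD !coefC !coefZ !coefX !mulr0 !addr0.
- by rewrite !rmorphD !coefD /= IHp IHq rmorphD.
- by rewrite !rmorphM /= !coef0M IHp IHq rmorphM.
Qed.

(** As before, two components would both pass through P. The quadratic leading
    term of p at P would then be the product of their gradients at P, two linear
    forms over F, and would vanish in some direction over F. Only the line of
    total contact lives over K: this is the situation of a double point with
    conjugate tangents. *)
Lemma total_contact_node_irreducible P Q e1 e2 p d c :
  restr iota (iota \o P) Q p = c *: 'X^d -> c != 0 -> msize p = d.+1 ->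
  (0 < d)%N ->
  (forall a b, (a, b) != (0, 0) ->
    (restr idfun P (fun i => a * e1 i + b * e2 i) p)`_2 != 0) ->
  mirreducible p.
Proof.
move=> rE c0 sp d0 node; apply: mirreducible_msize => [|g h pE g1 h1].
  by rewrite sp.
have vanish q R : (restr iota (iota \o P) Q q)`_0 = 0 -> (restr idfun P R q)`_0 = 0.
  by rewrite (restr_coef0_map _ _ R) => /eqP; rewrite fmorph_eq0 => /eqP.
have gP R := vanish g R (total_contact_vanish pE rE c0 sp g1).
have pE' : p = h * g by rewrite mulrC.
have hP R := vanish h R (total_contact_vanish pE' rE c0 sp h1).
have coef2 R : (restr idfun P R p)`_2 = (restr idfun P R g)`_1 * (restr idfun P R h)`_1.
  by rewrite pE rmorphM /= coef2M gP hP mul0r mulr0 add0r addr0.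
have [u gu] := restr_coef1_lin idfun P g.
pose l1 := \sum_i e1 i * u i; pose l2 := \sum_i e2 i * u i.
have gl a b : (restr idfun P (fun i => a * e1 i + b * e2 i) g)`_1 = a * l1 + b * l2.
  rewrite gu !mulr_sumr -big_split; apply: eq_bigr => i _ /=; ring.
have [l0 | nz_l] := eqVneq (l1, l2) (0, 0).
  have nz : (1, 0) != (0, 0) :> F * F by apply/eqP => -[/eqP]; rewrite oner_eq0.
  move/eqP: (node _ _ nz); apply.
  by case: l0 => l10 l20; rewrite coef2 gl l10 l20 !mulr0 addr0 mul0r.
(* The gradient of g takes the values l1 on e1 and l2 on e2, so it kills the
   direction l2 e1 - l1 e2. *)
have nz : (l2, - l1) != (0, 0).
  apply: contraNneq nz_l => -[-> /eqP]; rewrite oppr_eq0 => /eqP ->.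
  exact: eqxx.
move/eqP: (node _ _ nz); apply.
by rewrite coef2 gl (mulrC l2) mulNr subrr mul0r.
Qed.

End NodeIrreducibility.

(** * Linear changes of coordinates *)

Section LinearSubstitution.

Variable F : finFieldType.
Implicit Types (p r l : {mpoly F[3]}) (S T : 'M[F]_3).

Lemma msize_plane_curve d p : plane_curve d p -> msize p = d.+1.
Proof.
case/andP=> p0 hp; have := dhomog_uniq p0 hp (dhomog_msize hp) => ->.
by rewrite prednK // msize_gt0.
Qed.

Lemma line_irreducible l : line l -> mirreducible l.
Proof. by move/msize_plane_curve/mirreducible_deg1. Qed.

HB.instance Definition _ T := GRing.RMorphism.copy (lin_subst T)
  (comp_mpoly [tuple \sum_(j < 3) T i j *: 'X_j | i < 3]).

Lemma lin_substX T i : lin_subst T 'X_i = \sum_j T i j *: 'X_j.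
Proof. by rewrite /lin_subst comp_mpolyXU -tnth_nth tnth_mktuple. Qed.

Lemma lin_substC T c : lin_subst T c%:MP = c%:MP.
Proof. exact: comp_mpolyC. Qed.

Lemma lin_substZ T c p : lin_subst T (c *: p) = c *: lin_subst T p.
Proof. exact: comp_mpolyZ. Qed.

Lemma lin_subst1 p : lin_subst 1%:M p = p.
Proof.
elim/mpoly_ring_ind: p => [c|i|p q IHp IHq|p q IHp IHq].
- by rewrite lin_substC.
- rewrite lin_substX (bigD1 i) //= mxE eqxx scale1r big1 ?addr0 // => j ji.
  by rewrite mxE eq_sym (negbTE ji) scale0r.
- by rewrite rmorphD /= IHp IHq.
- by rewrite rmorphM /= IHp IHq.
Qed.

(** Substitution is contravariant: p(T x) becomes p(T S x) when x is replaced by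
    S x. *)
Lemma lin_subst_comp S T p : lin_subst S (lin_subst T p) = lin_subst (T *m S) p.
Proof.
elim/mpoly_ring_ind: p => [c|i|p q IHp IHq|p q IHp IHq].
- by rewrite !lin_substC.
- rewrite !lin_substX rmorph_sum /=.
  under eq_bigr => j _ do rewrite lin_substZ lin_substX scaler_sumr.
  rewrite exchange_big; apply: eq_bigr => k _ /=.
  by rewrite mxE scaler_suml; apply: eq_bigr => j _; rewrite scalerA.
- by rewrite !rmorphD /= IHp IHq.
- by rewrite !rmorphM /= IHp IHq.
Qed.

Lemma lin_substK T : T \in unitmx -> cancel (lin_subst T) (lin_subst (invmx T)).
Proof. by move=> Tu p; rewrite lin_subst_comp mulmxV // lin_subst1. Qed.

Lemma lin_subst_dhomog T d p : p \is d.-homog -> lin_subst T p \is d.-homog.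
Proof.
move/dhomogP => hp; rewrite [p]mpolyE raddf_sum /= big_seq.
apply: rpred_sum => m m_in; rewrite lin_substZ; apply: rpredZ.
rewrite -(hp _ m_in) /= mdegE /lin_subst comp_mpolyX.
elim/big_rec2: _ => [|i k q _ IH]; first exact: dhomog1.
apply: dhomogM IH; rewrite tnth_mktuple -[X in X.-homog]mul1n.
by apply/dhomogMn/rpred_sum => j _; apply: rpredZ; rewrite dhomogX /= mdeg1.
Qed.

Lemma lin_subst_eq0 T p : T \in unitmx -> (lin_subst T p == 0) = (p == 0).
Proof.
move=> Tu; apply/eqP/eqP => [E|->]; last by rewrite rmorph0.
by rewrite -(lin_substK Tu p) E rmorph0.
Qed.

Lemma lin_subst_plane_curve T d p :
  T \in unitmx -> plane_curve d p -> plane_curve d (lin_subst T p).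
Proof.
move=> Tu /andP[p0 hp].
by rewrite /plane_curve lin_subst_eq0 // p0 lin_subst_dhomog.
Qed.

Lemma lin_subst_unit T p :
  T \in unitmx -> (lin_subst T p \is a GRing.unit) = (p \is a GRing.unit).
Proof.
move=> Tu; apply/idP/idP => [|pu]; last exact: rmorph_unit.
by rewrite -{2}(lin_substK Tu p); apply: rmorph_unit.
Qed.

Lemma lin_subst_irreducible T p :
  T \in unitmx -> mirreducible p -> mirreducible (lin_subst T p).
Proof.
move=> Tu [p0 pu pgh]; split; rewrite ?lin_subst_eq0 ?lin_subst_unit //.
move=> g h E; have Vu : invmx T \in unitmx by rewrite unitmx_inv.
rewrite -(lin_subst_unit g Vu) -(lin_subst_unit h Vu); apply: pgh.
by rewrite -rmorphM -E /= lin_substK.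
Qed.

Lemma lin_subst_same_curve T p r :
  T \in unitmx -> same_curve (lin_subst T p) (lin_subst T r) = same_curve p r.
Proof.
move=> Tu; apply/existsP/existsP => -[c /andP[c0 /eqP E]]; exists c; rewrite c0 /=.
  by rewrite -(lin_substK Tu p) E lin_substZ lin_substK.
by rewrite E lin_substZ.
Qed.

Lemma lin_subst_distinct T (s : seq {mpoly F[3]}) :
  T \in unitmx -> distinct_curves s -> distinct_curves [seq lin_subst T l | l <- s].
Proof.
move=> Tu; rewrite /distinct_curves pairwise_map; apply: sub_pairwise => p r.
by rewrite /= lin_subst_same_curve.
Qed.

Lemma lin_subst_passes T p (P : 'rV[F]_3) :
  passes_through (lin_subst T p) P = passes_through p (P *m T^T).
Proof.
rewrite /passes_through /lin_subst comp_mpoly_meval.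
congr (_ == 0); apply: meval_eq => i; rewrite tnth_mktuple raddf_sum mxE /=.
by apply: eq_bigr => j _; rewrite mevalZ mevalXU !mxE mulrC.
Qed.

Lemma lin_subst_all_pass T (s : seq {mpoly F[3]}) (P : 'rV[F]_3) : T \in unitmx ->
  all (fun l => passes_through l (P *m invmx T^T)) [seq lin_subst T l | l <- s]
  = all (fun l => passes_through l P) s.
Proof.
move=> Tu; rewrite all_map; apply: eq_all => l /=.
by rewrite lin_subst_passes mulmxKV // unitmx_tr.
Qed.

End LinearSubstitution.

(** * The filling form as a determinant *)

Section FillingForm.

Variable F : finFieldType.
Implicit Types (A B S T : 'M[F]_3) (a c : F).

Local Notation q := #|F|.
Local Notation i0 := (@Ordinal 3 0 isT).
Local Notation i1 := (@Ordinal 3 1 isT).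
Local Notation i2 := (@Ordinal 3 2 isT).

(** This is what makes raising to the power q additive in any commutative
    F-algebra. *)
Lemma card_pchar_nat (R : comNzRingType) (f : {rmorphism F -> R}) :
  [pchar R].-nat q.
Proof.
have [p p_pr pF] := finPcharP F.
have := pprimeChar_pgroup pF; rewrite pgroupE cardsT => pq.
apply: sub_in_pnat pq => r _; rewrite inE => /eqP ->.
exact: rmorph_pchar pF.
Qed.

Definition coords : 'rV[{mpoly F[3]}]_3 := \row_j 'X_j.
Definition frobs : 'rV[{mpoly F[3]}]_3 := \row_j 'X_j ^+ q.

Lemma ord3P (P : 'I_3 -> Prop) : P i0 -> P i1 -> P i2 -> forall i, P i.
Proof.
move=> P0 P1 P2 [[|[|[|i]]] lti] //; [move: P0 | move: P1 | move: P2];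
  by congr P; apply: val_inj.
Qed.

Lemma sum3E (V : nmodType) (f : 'I_3 -> V) : \sum_i f i = f i0 + f i1 + f i2.
Proof.
rewrite !big_ord_recl big_ord0 addr0 addrA.
by congr (f _ + f _ + f _); apply: val_inj.
Qed.

Lemma det3E (R : comNzRingType) (M : 'M[R]_3) :
  \det M = M i0 i0 * (M i1 i1 * M i2 i2 - M i1 i2 * M i2 i1)
         - M i0 i1 * (M i1 i0 * M i2 i2 - M i1 i2 * M i2 i0)
         + M i0 i2 * (M i1 i0 * M i2 i1 - M i1 i1 * M i2 i0).
Proof.
pose m i j := M (inord i) (inord j).
have -> : M = \matrix_(i < 3, j < 3) m i j.
  by apply/matrixP => i j; rewrite mxE /m !inord_val.
rewrite (expand_det_row _ i0) sum3E /cofactor.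
rewrite !(expand_det_row _ ord0) !big_ord_recl !big_ord0 /cofactor !det_mx11.
rewrite !mxE /= /bump /=; ring.
Qed.

(** (U, V, W) is the cross product of the last two rows, so the filling form is
    the triple product of the three rows. *)
Definition fill_mx A : 'M[{mpoly F[3]}]_3 :=
  \matrix_(i < 3) nth 0 [:: coords *m map_mx (@mpolyC 3 F) A; frobs; coords] i.

Lemma fillF_sum A :
  fillF A = (\sum_i (A i i0)%:MP * 'X_i) * fillU F
          + (\sum_i (A i i1)%:MP * 'X_i) * fillV F
          + (\sum_i (A i i2)%:MP * 'X_i) * fillW F.
Proof.
rewrite /fillF /bilin mxE sum3E; congr (_ + _ + _);
rewrite !mxE /=; congr (_ * _); apply: eq_bigr => k _; move: k; apply: ord3P;
by rewrite !mxE /= mulrC.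
Qed.

Lemma fillF_det A : fillF A = \det (fill_mx A).
Proof.
rewrite fillF_sum !sum3E det3E.
rewrite /fill_mx !mxE /= ?mxE !sum3E ?mxE /= /fillU /fillV /fillW /Xx /Xy /Xz.
ring.
Qed.

Lemma lin_subst_coords T : map_mx (lin_subst T) coords = coords *m map_mx (@mpolyC 3 F) T^T.
Proof.
apply/rowP => j; rewrite !mxE lin_substX; apply: eq_bigr => k _.
by rewrite !mxE -mul_mpolyC mulrC.
Qed.

(** Raising to the power q is additive and fixes F, hence it commutes with linear
    substitutions over F. *)
Lemma lin_subst_frobs T : map_mx (lin_subst T) frobs = frobs *m map_mx (@mpolyC 3 F) T^T.
Proof.
have frobD (u v : {mpoly F[3]}) : (u + v) ^+ q = u ^+ q + v ^+ q.
  by apply/exprDn_pchar/(card_pchar_nat (@mpolyC 3 F)).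
apply/rowP => j; rewrite !mxE rmorphXn /= lin_substX.
elim/big_rec2: _ => [|k u v _ IH]; first by rewrite expr0n gtn_eqF // ltnW ?finNzRing_gt1.
rewrite frobD -IH !mxE; congr (_ + _).
by rewrite -mul_mpolyC exprMn -rmorphXn expf_card mulrC.
Qed.

(** Under the hypothesis on T, the substitution multiplies all three rows of the
    determinant by the same matrix T^T on the right. *)
Lemma lin_subst_fillF T A B :
  T^T *m B = A *m T^T -> lin_subst T (fillF B) = \det T *: fillF A.
Proof.
move=> TB; rewrite !fillF_det -[lin_subst T _]/((lin_subst T : {rmorphism _ -> _}) _).
rewrite -det_map_mx -mul_mpolyC -[\det T]det_tr -det_map_mx mulrC -det_mulmx.
congr (\det _); apply/row_matrixP; apply: ord3P;
  rewrite row_mul -map_row !rowK /=.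
- have CB : map_mx (lin_subst T) (map_mx (@mpolyC 3 F) B) = map_mx (@mpolyC 3 F) B.
    by apply/matrixP => i j; rewrite !mxE lin_substC.
  by rewrite map_mxM lin_subst_coords CB -!mulmxA -!map_mxM TB.
- exact: lin_subst_frobs.
- exact: lin_subst_coords.
Qed.

Definition mx33 (s : seq (seq F)) : 'M[F]_3 :=
  \matrix_(i < 3, j < 3) nth 0 (nth [::] s i) j.

Lemma fillF_mx33 (s : seq (seq F)) (m := fun i j => (nth 0 (nth [::] s i) j)%:MP_[3]) :
  fillF (mx33 s)
  = (m 0%N 0%N * Xx F + m 1%N 0%N * Xy F + m 2%N 0%N * Xz F) * fillU F
  + (m 0%N 1%N * Xx F + m 1%N 1%N * Xy F + m 2%N 1%N * Xz F) * fillV F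
  + (m 0%N 2%N * Xx F + m 1%N 2%N * Xy F + m 2%N 2%N * Xz F) * fillW F.
Proof. by rewrite fillF_sum !sum3E !mxE /=. Qed.

Lemma fillF_scalar a : fillF a%:M = 0.
Proof.
rewrite fillF_sum !sum3E !mxE /= /fillU /fillV /fillW /Xx /Xy /Xz !mulr0n !mulr1n mpolyC0.
ring.
Qed.

(** Replacing A by A - a E subtracts a multiple of the row (x, y, z) from the first
    row of the determinant. *)
Lemma fillF_sub_scalar A a : fillF (A - a%:M) = fillF A.
Proof.
have fD B C : fillF (B + C) = fillF B + fillF C.
  rewrite !fillF_sum !sum3E !mxE !mpolyCD; ring.
by rewrite fD -scaleN1r scale_scalar_mx fillF_scalar addr0.
Qed.

Lemma same_curve_refl (p : {mpoly F[3]}) : same_curve p p.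
Proof. by apply/existsP; exists 1; rewrite oner_neq0 scale1r eqxx. Qed.

Section Transport.

Variables (A B S : 'M[F]_3) (a : F).
Hypotheses (Su : S \in unitmx) (SA : S *m (A - a%:M) = B *m S).

Let T := (invmx S)^T.

Lemma transport_unit : T \in unitmx.
Proof. by rewrite unitmx_tr unitmx_inv. Qed.

(** The rows of S are the basis in which A - a E has the matrix B, and T expresses
    the coordinates in that basis through the original ones. *)
Lemma splits_into_similar (s : seq {mpoly F[3]}) :
  splits_into (fillF B) s -> splits_into (fillF A) [seq lin_subst T r | r <- s].
Proof.
case=> irr_s /existsP[c /andP[c0 /eqP E]]; split.
  by move=> _ /mapP[r r_s ->]; apply/lin_subst_irreducible/irr_s => //; apply: transport_unit.
have d0 : \det T != 0 by rewrite -unitfE -unitmxE transport_unit.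
have TA : lin_subst T (fillF B) = \det T *: fillF A.
  rewrite -(fillF_sub_scalar A a); apply: lin_subst_fillF.
  by rewrite /T trmxK -[B](mulmxK Su) -SA !mulmxA mulVmx // mul1mx.
apply/existsP; exists ((\det T)^-1 * c); rewrite mulf_neq0 ?invr_eq0 //=.
rewrite big_map -scalerA -(rmorph_prod (lin_subst T)) -lin_substZ -E TA.
by rewrite scalerA mulVf // scale1r.
Qed.

End Transport.

(** * Irreducibility of curve2, curve3 and curve4 *)

Lemma card_predK : q = q.-1.+1.
Proof. by rewrite prednK // ltnW ?finNzRing_gt1. Qed.

Lemma card_pred_gt0 : (0 < q.-1)%N.
Proof. by have := finNzRing_gt1 F; case: q => [|[]]. Qed.

Lemma natr_card : q%:R = 0 :> F.
Proof.
have := expg_cardG (in_setT (1 : F)); rewrite cardsT => E.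
by rewrite -FinRing.zmodXgE E.
Qed.

Lemma Xn_homog n (i : 'I_n) k : ('X_i ^+ k : {mpoly F[n]}) \is k.-homog.
Proof. by rewrite -[X in X.-homog]mul1n dhomogMn // dhomogX /= mdeg1. Qed.

Lemma X_homog n (i : 'I_n) : ('X_i : {mpoly F[n]}) \is 1%N.-homog.
Proof. exact: (Xn_homog i 1). Qed.

Lemma dhomogM_eq n d e k (p r : {mpoly F[n]}) :
  (d + e)%N = k -> p \is d.-homog -> r \is e.-homog -> p * r \is k.-homog.
Proof. by move=> <-; apply: dhomogM. Qed.

Definition pt (K : fieldType) (s : seq K) (i : 'I_3) : K := nth 0 s i.

Lemma restr_neq0 (K : fieldType) (iota : {rmorphism F -> K}) P Q d (c : K) (p : {mpoly F[3]}) :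
  restr iota P Q p = c *: 'X^d -> c != 0 -> p != 0.
Proof.
move=> E c0; apply/eqP => p0; move/eqP: E.
by rewrite p0 rmorph0 eq_sym scaler_eq0 (negbTE c0) -size_poly_eq0 size_polyXn.
Qed.

Lemma restr_curve (K : fieldType) (iota : {rmorphism F -> K}) (P Q : seq K) i :
  restr iota (pt P) (pt Q) 'X_i = (P`_i)%:P + Q`_i *: 'X.
Proof. exact: restrX. Qed.

Lemma curve3_restr :
  restr idfun (pt [:: 0; 0; 1]) (pt [:: 0; 1; 0]) (curve3 F) = (-1 : F) *: 'X^q.
Proof.
rewrite /curve3 /Xx /Xy /Xz !(rmorphB, rmorphD, rmorphM, rmorphXn) /= !restr_curve /=.
rewrite card_predK !exprS.
rewrite !scale0r !addr0 !mul0r expr0n (gtn_eqF card_pred_gt0) scale1r scaleN1r.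
by rewrite polyC0 subrr mul0r !add0r.
Qed.

Lemma curve3_plane : plane_curve q (curve3 F).
Proof.
rewrite /plane_curve (restr_neq0 curve3_restr) ?oppr_eq0 ?oner_eq0 //=.
rewrite /curve3 /Xx /Xy /Xz !(rpredB, rpredD, rpredN) ?Xn_homog //.
- by apply: dhomogM_eq (X_homog i0) (Xn_homog i2 q.-1); rewrite add1n -card_predK.
- by apply: dhomogM_eq (Xn_homog i0 q.-1) (X_homog i1); rewrite addn1 -card_predK.
Qed.

(** The curve is smooth at (0 : 0 : 1) and its tangent x = 0 there meets it nowhere
    else, since only - y^q survives on that line. *)
Lemma curve3_irreducible : mirreducible (curve3 F).
Proof.
apply: (total_tangency_irreducible (R := pt [:: 1; 0; 0]) curve3_restr).
- by rewrite oppr_eq0 oner_eq0.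
- exact: msize_plane_curve curve3_plane.
- by rewrite card_predK.
rewrite /curve3 /Xx /Xy /Xz !(rmorphB, rmorphD, rmorphM, rmorphXn) /= !restr_curve /=.
rewrite !scale0r !addr0 !mulr0 !polyC0 !polyC1 !expr1n mulr1 scale1r add0r.
rewrite addr0 card_predK [0 ^+ _.+1]exprS mul0r subr0.
rewrite coefB coefXn coefX eqSS (ltn_eqF card_pred_gt0) sub0r.
by rewrite oppr_eq0 oner_eq0.
Qed.

Lemma curve4_restr :
  restr idfun (pt [:: 0; 1; 0]) (pt [:: 1; 0; 0]) (curve4 F) = (1 : F) *: 'X^(q.+1).
Proof.
rewrite /curve4 /Xx /Xy /Xz !(rmorphB, rmorphD, rmorphM, rmorphXn) /= !restr_curve /=.
rewrite !scale0r !addr0 !polyC0 add0r !scale1r card_predK !(exprS 0) !expr0n.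
by rewrite (gtn_eqF card_pred_gt0) !mul0r !mulr0 !subr0 addr0.
Qed.

Lemma curve4_plane : plane_curve q.+1 (curve4 F).
Proof.
rewrite /plane_curve (restr_neq0 curve4_restr) ?oner_eq0 //=.
rewrite /curve4 /Xx /Xy /Xz !(rpredB, rpredD, rpredN) ?Xn_homog //.
- by apply: dhomogM_eq (Xn_homog i0 2) (Xn_homog i2 q.-1); rewrite add2n -card_predK.
- by apply: dhomogM_eq (Xn_homog i1 q) (X_homog i2); rewrite addn1.
- by apply: dhomogM_eq (X_homog i1) (Xn_homog i2 q); rewrite add1n.
Qed.

(** The curve is smooth at (0 : 1 : 0) and its tangent z = 0 there meets it nowhere
    else, since only x^(q+1) survives on that line. *)
Lemma curve4_irreducible : mirreducible (curve4 F).
Proof.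
apply: (total_tangency_irreducible (R := pt [:: 0; 0; 1]) curve4_restr).
- by rewrite oner_eq0.
- exact: msize_plane_curve curve4_plane.
- by [].
rewrite /curve4 /Xx /Xy /Xz !(rmorphB, rmorphD, rmorphM, rmorphXn) /= !restr_curve /=.
rewrite !scale0r !addr0 !polyC0 !polyC1 !expr1n !mul1r scale1r add0r.
rewrite !exprS !mul0r subr0 add0r.
rewrite coefB coefX coefXn card_predK eqSS (ltn_eqF card_pred_gt0) subr0.
by rewrite oner_eq0.
Qed.

Lemma coef1X (K : fieldType) (p : {poly K}) k :
  (p ^+ k.+1)`_1 = k.+1%:R * p`_0 ^+ k * p`_1.
Proof.
elim: k => [|k IH]; first by rewrite expr1 expr0 !mul1r.
rewrite exprS coef1M IH.
have -> : (p ^+ k.+1)`_0 = p`_0 ^+ k.+1 by rewrite -!horner_coef0 hornerE.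
rewrite [in RHS]mulrS !exprS; ring.
Qed.

Lemma curve2_restr (K : fieldType) (iota : {rmorphism F -> K}) a b c z :
  iota a * z ^+ q.-1 + iota b = 0 ->
  restr iota (pt [:: z; 1; 0]) (pt [:: 0; 0; 1]) (curve2 a b c) = iota c *: 'X^(q.-1).
Proof.
move=> z_root.
rewrite /curve2 /Xx /Xy /Xz !rmorphD /= !restrZ !rmorphXn /= !restr_curve /=.
rewrite !scale0r !addr0 scale1r add0r polyC1 expr1n -rmorphXn /=.
by rewrite -!mul_polyC -rmorphM mulr1 -rmorphD z_root add0r.
Qed.

(** Let w satisfy a w^(q-1) + b = 0 in an algebraic closure. On the line joining
    (w : 1 : 0) to (0 : 0 : 1) only c z^(q-1) survives, and at (w : 1 : 0) the
    derivative in x is - a w^(q-2), which is nonzero. *)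
Lemma curve2_plane_irreducible a b c : a * b * c != 0 ->
  plane_curve q.-1 (curve2 a b c) /\ mirreducible (curve2 a b c).
Proof.
rewrite !mulf_eq0 !negb_or => /andP[/andP[a0 b0] c0].
have [K [iota _]] := countable_algebraic_closure F.
have n0 := card_pred_gt0.
have [z z_root] : exists z, iota a * z ^+ q.-1 + iota b = 0.
  have /closed_rootP[z] : size (iota a *: 'X^(q.-1) + (iota b)%:P) != 1%N.
    rewrite size_polyDl size_scale ?fmorph_eq0 ?size_polyXn ?eqSS -?lt0n //.
    by rewrite (leq_ltn_trans (size_polyC_leq1 _)).
  by rewrite rootE !hornerE => /eqP; exists z.
have z0 : z != 0.
  apply: contraNneq b0 => z0; move: z_root.
  rewrite z0 expr0n (gtn_eqF n0) mulr0 add0r => /eqP.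
  by rewrite fmorph_eq0.
have rE := curve2_restr c z_root.
have c0' : iota c != 0 by rewrite fmorph_eq0.
have plane : plane_curve q.-1 (curve2 a b c).
  by rewrite /plane_curve (restr_neq0 rE c0') /= /curve2 /Xx /Xy /Xz !rpredD ?rpredZ ?Xn_homog.
split=> //; apply: (total_tangency_irreducible (R := pt [:: 1; 0; 0]) rE c0') => //.
  exact: msize_plane_curve plane.
rewrite /curve2 /Xx /Xy /Xz !rmorphD /= !restrZ !rmorphXn /= !restr_curve /=.
rewrite !scale0r !addr0 scale1r polyC0 polyC1 expr1n expr0n (gtn_eqF n0) scaler0 addr0.
rewrite coefD !coefZ coefC mulr0 addr0 -(prednK n0) coef1X !coefD !coefX !coefC /=.
rewrite addr0 add0r mulr1 !mulf_neq0 ?fmorph_eq0 ?expf_neq0 //.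
have qN1 : q.-1%:R = -1 :> F.
  by apply/eqP; rewrite -addr_eq0 -mulrSr -card_predK natr_card.
by rewrite prednK // -(rmorph_nat iota) fmorph_eq0 qN1 oppr_eq0 oner_eq0.
Qed.

(** * The nodal curve curve1 *)

Definition mx23 (s : seq (seq F)) : 'M[F]_(2, 3) :=
  \matrix_(i < 2, j < 3) nth 0 (nth [::] s i) j.

Lemma sum2E (V : nmodType) (f : 'I_2 -> V) : \sum_i f i = f (@Ordinal 2 0 isT) + f (@Ordinal 2 1 isT).
Proof.
rewrite !big_ord_recl big_ord0 addr0.
by congr (f _ + f _); apply: val_inj.
Qed.

Section NodalCurve.

Variables (a g0 g1 : F).

Let g : {poly F} := 'X^2 + g1 *: 'X + g0%:P.
Hypothesis g_irr : irreducible_poly g.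

(** The coefficients are those of the residual curve in the basis found by
    normal_form_nodal, for a matrix with characteristic polynomial (X - a) g; the
    quadratic part of this matrix is then g made homogeneous. *)
Definition nodal_mx : 'M[F]_(2, 3) := mx23 [:: [:: 1; g1 + a; 0]; [:: - a; g0; 0]].

Lemma curve1E :
  curve1 nodal_mx
  = ('X_i0 ^+ q - 'X_i0 * 'X_i2 ^+ q.-1) * ('X_i0 + (g1 + a) *: 'X_i1)
  + ('X_i1 ^+ q - 'X_i1 * 'X_i2 ^+ q.-1) * (g0 *: 'X_i1 - a *: 'X_i0).
Proof.
rewrite /curve1 /bilin mxE sum3E !mxE !sum2E !mxE /= /Xx /Xy /Xz -!mul_mpolyC.
rewrite mpolyC1 mpolyC0 mpolyCD mpolyCN; ring.
Qed.

Lemma quad_partE :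
  quad_part nodal_mx
  = 'X_(@Ordinal 2 0 isT) ^+ 2 + g1 *: ('X_(@Ordinal 2 0 isT) * 'X_(@Ordinal 2 1 isT))
    + g0 *: 'X_(@Ordinal 2 1 isT) ^+ 2.
Proof.
rewrite /quad_part /bilin mxE !sum2E !mxE !sum2E !mxE /= -!mul_mpolyC.
rewrite mpolyC1 mpolyCD mpolyCN; ring.
Qed.

Lemma size_nodal_poly : size g = 3%N.
Proof.
have small : (size (g1 *: 'X + g0%:P)%R < size ('X^2 : {poly F}))%N.
  rewrite size_polyXn ltnS (leq_trans (size_polyD _ _)) // geq_max.
  rewrite (leq_trans (size_scale_leq _ _)) ?size_polyX //.
  by rewrite (leq_trans (size_polyC_leq1 _)).
by rewrite /g -addrA size_polyDl // size_polyXn.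
Qed.

Lemma nodal_poly_no_root x : ~~ root g x.
Proof.
apply/negP => gx; case: g_irr => _ g_min.
have := g_min ('X - x%:P); rewrite size_XsubC dvdp_XsubCl => /(_ isT gx)/eqp_size.
by rewrite size_XsubC size_nodal_poly.
Qed.

(** Setting the second variable to 1 turns the quadratic part into g without loss
    of degree, so a proper factorization would restrict to one of g. *)
Lemma quad_part_irreducible : mirreducible (quad_part nodal_mx).
Proof.
pose P (i : 'I_2) : F := nth 0 [:: 0; 1] i; pose Q (i : 'I_2) : F := nth 0 [:: 1; 0] i.
have rE : restr idfun P Q (quad_part nodal_mx) = g.
  rewrite quad_partE !rmorphD /= !restrZ !rmorphXn rmorphM /= !restrX /P /Q /=.
  by rewrite scale1r scale0r add0r addr0 expr1n mulr1 alg_polyC.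
have p0 : quad_part nodal_mx != 0.
  apply/eqP => p0; have := size_nodal_poly.
  by rewrite -rE p0 rmorph0 size_poly0.
have sz : size (restr idfun P Q (quad_part nodal_mx)) = msize (quad_part nodal_mx).
  apply/eqP; rewrite eqn_leq size_restr rE size_nodal_poly /=.
  have hom : quad_part nodal_mx \is 2%N.-homog.
    rewrite quad_partE !rpredD ?rpredZ //.
    - exact: Xn_homog.
    - by apply: dhomogM_eq (X_homog (@Ordinal 2 0 isT)) (X_homog (@Ordinal 2 1 isT)).
    - exact: Xn_homog.
  have E := dhomog_uniq p0 hom (dhomog_msize hom).
  by rewrite -(prednK (msize_gt0 p0)) -E.
apply: mirreducible_msize => [|h k pE h1 k1].
  by rewrite -sz rE size_nodal_poly.
have [sh sk] := restr_full_degree pE p0 sz.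
have rg : restr idfun P Q h * restr idfun P Q k = g by rewrite -rmorphM -pE.
case: g_irr => _ /(_ (restr idfun P Q h)); rewrite sh -rg dvdp_mulIl.
rewrite neq_ltn h1 orbT => /(_ isT isT)/eqp_size.
have r0 : restr idfun P Q h * restr idfun P Q k != 0.
  by rewrite rg -size_poly_eq0 size_nodal_poly.
move: r0; rewrite mulf_eq0 negb_or => /andP[r0 s0].
rewrite size_mul // sh sk.
by have := ltnW h1; lia.
Qed.

(** On a line through (0 : 0 : 1) only the terms of degrees 2 and q + 1 survive,
    so this point is a double point with leading term g made homogeneous. *)
Lemma curve1_restr (K : fieldType) (iota : {rmorphism F -> K}) x y :
  restr iota (pt [:: 0; 0; 1]) (pt [:: x; y; 0]) (curve1 nodal_mx)
  = (x ^+ q * (x + iota (g1 + a) * y) + y ^+ q * (iota g0 * y - iota a * x)) *: 'X^(q.+1)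
    - (x ^+ 2 + iota g1 * x * y + iota g0 * y ^+ 2) *: 'X^2.
Proof.
rewrite curve1E rmorphD !rmorphM !rmorphB !rmorphD !rmorphM !rmorphXn /= !restrZ !restr_curve /=.
rewrite polyC0 polyC1 !add0r scale0r addr0 expr1n !mulr1 -!mul_polyC !exprMn.
rewrite !(rmorphD, rmorphB, rmorphN, rmorphM, rmorphXn) /= [_ ^+ q.+1]exprS; ring.
Qed.

(** A root z of g in an algebraic closure gives a tangent at the double point
    (0 : 0 : 1). On it the quadratic term vanishes and what remains is c t^(q+1)
    with c = (z^q - z)(z + g1 + a), which is nonzero because z is not in F. *)
Lemma curve1_plane_irreducible :
  plane_curve q.+1 (curve1 nodal_mx) /\ mirreducible (curve1 nodal_mx).
Proof.
have [K [iota _]] := countable_algebraic_closure F.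
have [z gz] : exists z, root (map_poly iota g) z.
  by apply/closed_rootP; rewrite size_map_poly size_nodal_poly.
have z_root : z ^+ 2 + iota g1 * z + iota g0 = 0.
  move: gz; rewrite rootE /g !rmorphD /= map_polyXn map_polyZ map_polyX map_polyC /= !hornerE.
  by move/eqP.
have z_notin x : iota x != z.
  apply/eqP => xz; move: (nodal_poly_no_root x); rewrite -(fmorph_root iota).
  by rewrite xz gz.
have zq : z ^+ q != z.
  apply/eqP => zq; have : root (map_poly iota ('X^q - 'X)) z.
    by rewrite rmorphB /= map_polyXn map_polyX rootE !hornerE zq subrr.
  rewrite finField_genPoly rmorph_prod rootE horner_prod => /prodf_eq0[x _] /=.
  by rewrite map_polyXsubC hornerXsubC subr_eq0 eq_sym (negbTE (z_notin x)).
pose c := (z ^+ q - z) * (z + iota (g1 + a)).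
have c0 : c != 0.
  rewrite mulf_neq0 // ?subr_eq0 // addr_eq0 eq_sym -rmorphN.
  exact: z_notin.
have rE : restr iota (pt [:: 0; 0; 1]) (pt [:: z; 1; 0]) (curve1 nodal_mx) = c *: 'X^(q.+1).
  rewrite curve1_restr !expr1n !mulr1 z_root scale0r subr0; congr (_ *: _).
  rewrite mul1r /c rmorphD.
  have -> : iota g0 = - (z ^+ 2 + iota g1 * z).
    by apply/eqP; rewrite -addr_eq0 addrC z_root.
  ring.
have plane : plane_curve q.+1 (curve1 nodal_mx).
  rewrite /plane_curve (restr_neq0 rE c0) /= curve1E.
  have lin u v : u *: 'X_i0 + v *: 'X_i1 \is [in F[3], 1.-homog].
    by rewrite rpredD // rpredZ ?X_homog.
  have fr i : 'X_i ^+ q - 'X_i * 'X_i2 ^+ q.-1 \is [in F[3], q.-homog].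
    rewrite rpredB ?Xn_homog //.
    by apply: dhomogM_eq (X_homog i) (Xn_homog i2 q.-1); rewrite add1n -card_predK.
  rewrite rpredD //; apply: dhomogM_eq (addn1 q) (fr _) _.
    by rewrite -['X_i0]scale1r lin.
  by rewrite addrC -scaleNr lin.
split=> //.
have ptE : iota \o pt [:: 0; 0; 1] =1 pt [:: 0; 0; 1].
  by apply: ord3P; rewrite /= ?rmorph0 ?rmorph1.
have rE' : restr iota (iota \o pt [:: 0; 0; 1]) (pt [:: z; 1; 0]) (curve1 nodal_mx) = c *: 'X^(q.+1).
  rewrite -rE /restr /mmap; apply: eq_bigr => m _; congr (_ * _).
  by apply: mmap1_eq => i; rewrite ptE.
apply: (total_contact_node_irreducible (e1 := pt [:: 1; 0; 0]) (e2 := pt [:: 0; 1; 0]) rE' c0) => //.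
  exact: msize_plane_curve plane.
move=> x y xy0.
have -> : restr idfun (pt [:: 0; 0; 1]) (fun i => x * pt [:: 1; 0; 0] i + y * pt [:: 0; 1; 0] i) (curve1 nodal_mx)
   = restr idfun (pt [:: 0; 0; 1]) (pt [:: x; y; 0]) (curve1 nodal_mx).
  rewrite /restr /mmap; apply: eq_bigr => m _; congr (_ * _).
  apply: mmap1_eq; apply: ord3P; by rewrite /= ?mulr1 ?mulr0 ?addr0 ?add0r.
rewrite curve1_restr coefB !coefZ !coefXn /= card_predK !eqSS (ltn_eqF card_pred_gt0).
rewrite mulr0 mulr1 sub0r oppr_eq0.
have [y0 | y0] := eqVneq y 0.
  move: xy0; rewrite y0 mulr0 expr0n mulr0 !addr0 expf_eq0 /=.
  by apply: contraNneq => ->; rewrite eqxx.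
apply: contra (nodal_poly_no_root (x / y)) => /eqP xy_root.
rewrite rootE /g !hornerD hornerXn hornerZ hornerX hornerC.
have -> : (x / y) ^+ 2 + g1 * (x / y) + g0 = (x ^+ 2 + g1 * x * y + g0 * y ^+ 2) / y ^+ 2.
  by field.
by rewrite xy_root mul0r.
Qed.

Lemma fillF_nodal :
  fillF (mx33 [:: [:: - a; -1; 0]; [:: g0; - g1 - a; 0]; [:: 0; 0; 0]])
  = 'X_i2 * curve1 nodal_mx.
Proof.
rewrite fillF_mx33 curve1E /= /fillU /fillV /fillW /Xx /Xy /Xz -!mul_mpolyC.
rewrite !(mpolyC1, mpolyC0, mpolyCD, mpolyCB, mpolyCN) card_predK !exprS; ring.
Qed.

End NodalCurve.

(** * Filling forms of the other normal forms *)

Lemma fillF_diag a1 a2 a3 :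
  fillF (mx33 [:: [:: a1; 0; 0]; [:: 0; a2; 0]; [:: 0; 0; a3]])
  = 'X_i0 * ('X_i1 * ('X_i2 * curve2 (a3 - a2) (a1 - a3) (a2 - a1))).
Proof.
rewrite fillF_mx33 /= /fillU /fillV /fillW /curve2 /Xx /Xy /Xz -!mul_mpolyC.
rewrite !(mpolyC0, mpolyCB) card_predK !exprS /=; ring.
Qed.

Lemma fillF_jordan2 b :
  fillF (mx33 [:: [:: 0; - b; 0]; [:: 0; 0; 0]; [:: 0; 0; b]])
  = b *: ('X_i0 * ('X_i2 * curve3 F)).
Proof.
rewrite fillF_mx33 /= /fillU /fillV /fillW /curve3 /Xx /Xy /Xz -!mul_mpolyC.
rewrite !(mpolyC0, mpolyCN) card_predK !exprS /=; ring.
Qed.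

Lemma fillF_jordan3 :
  fillF (mx33 [:: [:: 0; -1; 0]; [:: 0; 0; 0]; [:: 1; 0; 0]]) = 'X_i2 * curve4 F.
Proof.
rewrite fillF_mx33 /= /fillU /fillV /fillW /curve4 /Xx /Xy /Xz.
rewrite !(mpolyC0, mpolyC1, mpolyCN) card_predK !exprS /=; ring.
Qed.

(** This is the factorization of X^q - X over F, made homogeneous. *)
Lemma prod_lines_field (K : fieldType) (iota : {rmorphism F -> K}) (y z : K) :
  z != 0 -> \prod_(c : F) (y - iota c * z) = y ^+ q - y * z ^+ q.-1.
Proof.
move=> z0; have E : \prod_(c : F) (y / z - iota c) = (y / z) ^+ q - y / z.
  have /(congr1 (fun p => (map_poly iota p).[y / z])) := finField_genPoly F.
  rewrite rmorphB /= map_polyXn map_polyX hornerD hornerN hornerXn hornerX => ->.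
  rewrite rmorph_prod horner_prod; apply: eq_bigr => c _.
  by rewrite /= map_polyXsubC hornerXsubC.
have -> : \prod_(c : F) (y - iota c * z) = z ^+ q * \prod_(c : F) (y / z - iota c).
  rewrite -prodr_const -big_split; apply: eq_bigr => c _ /=.
  by field.
rewrite E mulrBr -exprMn mulrCA divff // mulr1 card_predK !exprS; by field.
Qed.

Lemma fillU_lines : fillU F = 'X_i2 * \prod_(c <- enum F) ('X_i1 - c *: 'X_i2).
Proof.
rewrite big_enum /= /fillU /Xy /Xz.
have -> : \prod_(c : F) ('X_i1 - c *: 'X_i2) = 'X_i1 ^+ q - 'X_i1 * 'X_i2 ^+ q.-1 :> {mpoly F[3]}.
  (* The fraction field is where the quotient of the two variables makes sense. *)
  apply/eqP; rewrite -tofrac_eq; apply/eqP; rewrite rmorph_prod rmorphB rmorphM !rmorphXn /=.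
  rewrite -(@prod_lines_field _ (@tofrac {mpoly F[3]} \o @mpolyC 3 F)).
    by apply: eq_bigr => c _; rewrite /= -mul_mpolyC rmorphB rmorphM.
  rewrite tofrac_eq0; apply/eqP => X0; have := msizeX F U_(i2).
  by rewrite X0 msize0 mdeg1.
by rewrite card_predK !exprS; ring.
Qed.

(** For a matrix u r of rank one the determinant factors as the linear form u times
    the determinant of r, X^q and X, which is the product of the lines over F
    through the point r; here r = (1, 0, 0) and that product is U. *)
Lemma fillF_rank1 u0 u1 u2 :
  fillF (mx33 [:: [:: u0; 0; 0]; [:: u1; 0; 0]; [:: u2; 0; 0]])
  = (u0 *: 'X_i0 + u1 *: 'X_i1 + u2 *: 'X_i2) *
    ('X_i2 * \prod_(c <- enum F) ('X_i1 - c *: 'X_i2)).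
Proof.
rewrite -fillU_lines fillF_mx33 /= !mpolyC0 -!mul_mpolyC /Xx /Xy /Xz; ring.
Qed.

(** * Normal forms of the matrix *)

Definition rows3 (s : seq 'rV[F]_3) : 'M[F]_3 := \matrix_(i < 3) nth 0 s i.

Lemma mul_rows3 (u : 'rV[F]_3) s :
  u *m rows3 s = u 0 i0 *: nth 0 s 0 + u 0 i1 *: nth 0 s 1 + u 0 i2 *: nth 0 s 2.
Proof. by rewrite mulmx_sum_row sum3E !rowK. Qed.

Lemma rows3_unit s :
  (forall x y z : F, x *: nth 0 s 0 + y *: nth 0 s 1 + z *: nth 0 s 2 = 0 ->
    [/\ x = 0, y = 0 & z = 0]) ->
  rows3 s \in unitmx.
Proof.
move=> indep; rewrite -row_free_unit; apply: inj_row_free => u.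
rewrite mul_rows3 => /indep[u0 u1 u2].
by apply/rowP; apply: ord3P; rewrite mxE.
Qed.

Lemma rows3_similar N s (m : seq (seq F)) :
  (forall k, (k < 3)%N -> nth 0 s k *m N =
     nth 0 (nth [::] m k) 0 *: nth 0 s 0 + nth 0 (nth [::] m k) 1 *: nth 0 s 1
     + nth 0 (nth [::] m k) 2 *: nth 0 s 2) ->
  rows3 s *m N = mx33 m *m rows3 s.
Proof.
move=> sN; apply/row_matrixP => i.
by rewrite !row_mul rowK sN // mul_rows3 !mxE.
Qed.

Lemma nonzero_row (N : 'M[F]_3) : N != 0 -> exists w : 'rV_3, w *m N != 0.
Proof.
move=> N0; have [i] : exists i, row i N != 0.
  apply/existsP; apply: contraR N0; rewrite negb_exists => /forallP H.
  by apply/eqP/row_matrixP => i; rewrite row0; apply/eqP; rewrite -[_ == _]negbK.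
by rewrite rowE; exists (delta_mx 0 i).
Qed.

Lemma char_root_eigenvector A a :
  root (char_poly A) a -> exists2 v : 'rV_3, v != 0 & v *m A = a *: v.
Proof.
by rewrite -eigenvalue_root_char => /eigenvalueP[v vA v0]; exists v.
Qed.

Lemma horner_mx_XsubC A a : horner_mx A ('X - a%:P) = A - a%:M.
Proof. by rewrite rmorphB /= horner_mx_X horner_mx_C. Qed.

Lemma char_poly_scalar3 a : char_poly (a%:M : 'M[F]_3) = ('X - a%:P) ^+ 3.
Proof. by rewrite /char_poly /char_poly_mx map_scalar_mx -raddfB /= det_scalar. Qed.

Lemma mxminpoly_full_annihilator A (p : {poly F}) :
  mxminpoly A = char_poly A -> p != 0 -> (size p <= 3)%N -> horner_mx A p != 0.
Proof.
move=> mE p0 sp; rewrite -dvd_mxminpoly mE; apply/negP => /(dvdp_leq p0).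
by rewrite size_char_poly ltnNge sp.
Qed.

Lemma eig_sub (v : 'rV[F]_3) A a b : v *m A = a *: v -> v *m (A - b%:M) = (a - b) *: v.
Proof. by move=> vA; rewrite mulmxBr vA mul_mx_scalar scalerBl. Qed.

Lemma monic_quadraticE (g : {poly F}) :
  g \is monic -> size g = 3%N -> g = 'X^2 + g`_1 *: 'X + (g`_0)%:P.
Proof.
move=> g_mon g_sz; apply/polyP => k; rewrite !coefD coefXn coefZ coefX coefC.
case: k => [|[|[|k]]] /=; rewrite ?mulr1 ?mulr0 ?add0r ?addr0 //.
  by move/monicP: g_mon; rewrite lead_coefE g_sz.
by rewrite nth_default ?g_sz.
Qed.

(** As a is not a root of g, the space is the direct sum of the line spanned by an
    eigenvector v for a and the kernel of g(A). A nonzero w in this kernel is not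
    an eigenvector because g has no root, so w and w A are independent. The second
    basis vector is - w A rather than w A so that the residual curve has g itself,
    and not g(-X), as its quadratic part. *)
Lemma normal_form_nodal A a (g : {poly F}) (g0 := g`_0) (g1 := g`_1) :
  g \is monic -> size g = 3%N -> irreducible_poly g ->
  char_poly A = ('X - a%:P) * g ->
  exists2 S, S \in unitmx & S *m (A - a%:M)
    = mx33 [:: [:: - a; -1; 0]; [:: g0; - g1 - a; 0]; [:: 0; 0; 0]] *m S.
Proof.
move=> g_mon g_sz g_irr chA.
have gE : g = 'X^2 + g1 *: 'X + g0%:P := monic_quadraticE g_mon g_sz.
have no_root x : g.[x] != 0.
  by have := nodal_poly_no_root (g1 := g1) (g0 := g0); rewrite -gE => /(_ g_irr x).
have gA : horner_mx A g = A *m A + g1 *: A + g0%:M.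
  by rewrite gE !rmorphD /= linearZ rmorphXn /= horner_mx_X horner_mx_C.
have NgA : (A - a%:M) *m horner_mx A g = 0.
  have := Cayley_Hamilton A; rewrite chA rmorphM /= horner_mx_XsubC.
  by [].
have [v v0 vA] : exists2 v : 'rV_3, v != 0 & v *m A = a *: v.
  by apply: char_root_eigenvector; rewrite chA rootM root_XsubC eqxx.
have eig_g (u : 'rV_3) x : u *m A = x *: u -> u *m horner_mx A g = g.[x] *: u.
  move=> uA; rewrite gA !mulmxDr mulmxA uA -scalemxAl uA -scalemxAr uA mul_mx_scalar.
  by rewrite !scalerA -!scalerDl gE !hornerD hornerXn hornerZ hornerX hornerC.
(* By Cayley-Hamilton the rows of A - a E lie in the kernel of g(A). *)
have [w0 w0N] : exists w : 'rV_3, w *m (A - a%:M) != 0.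
  apply: nonzero_row; apply/eqP => /eqP; rewrite subr_eq0 => /eqP AE.
  have : ('X - a%:P) * g = ('X - a%:P) * ('X - a%:P) ^+ 2.
    by rewrite -chA {1}AE char_poly_scalar3 exprS.
  move/(mulfI (negbT (polyXsubC_eq0 a))) => E.
  by move: (no_root a); rewrite E horner_exp hornerXsubC subrr expr0n eqxx.
set w := w0 *m (A - a%:M) in w0N.
have wg : w *m horner_mx A g = 0 by rewrite /w -mulmxA NgA mulmx0.
clearbody w.
have wAA : w *m A *m A = - (g1 *: (w *m A)) - g0 *: w.
  move: wg; rewrite gA !mulmxDr mulmxA -scalemxAr mul_mx_scalar.
  move: (w *m A *m A) (w *m A) => w2 w1 E; apply/eqP; rewrite -subr_eq0; apply/eqP.
  by rewrite -[RHS]E; apply/rowP => j; rewrite !mxE; ring.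
pose s := [:: w; - (w *m A); v].
exists (rows3 s).
  apply: rows3_unit => x y z /= E.
  have z0 : z = 0.
    have := congr1 (fun u => u *m horner_mx A g) E.
    rewrite mul0mx !mulmxDl -!scalemxAl mulNmx -[w *m A *m _]mulmxA.
    have -> : A *m horner_mx A g = horner_mx A g *m A.
      by rewrite gA mulmxDl mulmxDr mulmxDl mulmxDr -mulmxA -scalemxAl -scalemxAr scalar_mxC.
    rewrite mulmxA wg mul0mx oppr0 !scaler0 !add0r (eig_g _ _ vA) scalerA => /eqP.
    by rewrite scaler_eq0 (negbTE v0) orbF mulf_eq0 (negbTE (no_root a)) orbF => /eqP.
  have xy : y *: (w *m A) = x *: w.
    by apply/eqP; rewrite eq_sym -subr_eq0 -scalerN -[X in X == 0]addr0 -[X in _ + X](scale0r v) -z0 E.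
  have y0 : y = 0.
    apply/eqP; apply/negPn/negP => y0.
    have wA : w *m A = (y^-1 * x) *: w by rewrite -scalerA -xy scalerK.
    move: wg; rewrite (eig_g _ _ wA) => /eqP.
    by rewrite scaler_eq0 (negbTE w0N) orbF (negbTE (no_root _)).
  move/eqP: xy; rewrite y0 scale0r eq_sym scaler_eq0 (negbTE w0N) orbF => /eqP x0.
  by [].
apply: rows3_similar => -[|[|[|]]] //= _.
- rewrite mulmxBr mul_mx_scalar; move: (w *m A) => w1.
  by apply/rowP => j; rewrite !mxE; ring.
- rewrite mulNmx mulmxBr mul_mx_scalar wAA; move: (w *m A) => w1.
  by apply/rowP => j; rewrite !mxE; ring.
- by rewrite (eig_sub _ vA) subrr !scale0r !addr0.
Qed.

Lemma normal_form_diag A a1 a2 a3 :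
  uniq [:: a1; a2; a3] ->
  char_poly A = ('X - a1%:P) * ('X - a2%:P) * ('X - a3%:P) ->
  exists2 S, S \in unitmx & S *m (A - 0%:M)
    = mx33 [:: [:: a1; 0; 0]; [:: 0; a2; 0]; [:: 0; 0; a3]] *m S.
Proof.
rewrite /= !inE negb_or andbT => /andP[/andP[a12 a13] a23] chA.
have rt a : root (char_poly A) a = [|| a == a1, a == a2 | a == a3].
  by rewrite chA !rootM !root_XsubC orbA.
have [v1 v1_0 vA1] : exists2 v : 'rV_3, v != 0 & v *m A = a1 *: v.
  by apply: char_root_eigenvector; rewrite rt eqxx.
have [v2 v2_0 vA2] : exists2 v : 'rV_3, v != 0 & v *m A = a2 *: v.
  by apply: char_root_eigenvector; rewrite rt eqxx orbT.
have [v3 v3_0 vA3] : exists2 v : 'rV_3, v != 0 & v *m A = a3 *: v.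
  by apply: char_root_eigenvector; rewrite rt eqxx !orbT.
exists (rows3 [:: v1; v2; v3]).
  apply: rows3_unit => x y z /= E.
  have coef0 b c e t (v : 'rV[F]_3) : v != 0 -> b != c -> b != e ->
      (b - c) * ((b - e) * t) *: v = 0 -> t = 0.
    move=> /negbTE v0 bc be /eqP; rewrite scaler_eq0 v0 orbF !mulf_eq0 !subr_eq0.
    by rewrite (negbTE bc) (negbTE be) => /eqP.
  (* Two factors A - b E, A - c E leave one term of a relation between the
     eigenvectors. *)
  have kill b c : x *: v1 *m (A - b%:M) *m (A - c%:M) + y *: v2 *m (A - b%:M) *m (A - c%:M)
     + z *: v3 *m (A - b%:M) *m (A - c%:M) = 0.
    by rewrite -!mulmxDl E !mul0mx.
  have {}kill b c : (a1 - b) * ((a1 - c) * x) *: v1 + (a2 - b) * ((a2 - c) * y) *: v2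
     + (a3 - b) * ((a3 - c) * z) *: v3 = 0.
    rewrite -[RHS](kill b c) -!scalemxAl !(eig_sub _ vA1, eig_sub _ vA2, eig_sub _ vA3).
    rewrite -!scalemxAl !(eig_sub _ vA1, eig_sub _ vA2, eig_sub _ vA3).
    by apply/rowP => j; rewrite !mxE; ring.
  split.
  - apply: (coef0 a1 a2 a3 _ v1) => //; rewrite -[RHS](kill a2 a3).
    by apply/rowP => j; rewrite !mxE; ring.
  - apply: (coef0 a2 a1 a3 _ v2) => //; first by rewrite eq_sym.
    by rewrite -[RHS](kill a1 a3); apply/rowP => j; rewrite !mxE; ring.
  - apply: (coef0 a3 a1 a2 _ v3) => //; try by rewrite eq_sym.
    by rewrite -[RHS](kill a1 a2); apply/rowP => j; rewrite !mxE; ring.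
apply: rows3_similar => -[|[|[|]]] //= _; rewrite raddf0 subr0 ?vA1 ?vA2 ?vA3;
  by rewrite !scale0r ?addr0 ?add0r.
Qed.

(** The first two basis vectors span the generalized eigenspace of a. The factor
    - d^-1 on the second makes the residual curve equal to curve3. *)
Lemma normal_form_jordan2 A a b (d := b - a) :
  a != b -> char_poly A = ('X - a%:P) ^+ 2 * ('X - b%:P) ->
  mxminpoly A = char_poly A ->
  exists2 S, S \in unitmx & S *m (A - a%:M)
    = mx33 [:: [:: 0; - d; 0]; [:: 0; 0; 0]; [:: 0; 0; d]] *m S.
Proof.
move=> ab chA mA; have d0 : d != 0 by rewrite subr_eq0 eq_sym.
have [v v0 vA] : exists2 v : 'rV_3, v != 0 & v *m A = b *: v.
  by apply: char_root_eigenvector; rewrite chA rootM root_XsubC eqxx orbT.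
have vN : v *m (A - a%:M) = d *: v := eig_sub a vA.
have NN : (A - b%:M) *m (A - a%:M) *m (A - a%:M) = 0.
  have := Cayley_Hamilton A; rewrite chA mulrC expr2 !rmorphM /= !horner_mx_XsubC.
  by rewrite -mulmxE mulmxA.
have [w0 w0N] : exists w : 'rV_3, w *m ((A - b%:M) *m (A - a%:M)) != 0.
  apply: nonzero_row; rewrite -!horner_mx_XsubC mulmxE -rmorphM /=.
  apply: mxminpoly_full_annihilator => //.
    by rewrite mulf_neq0 // polyXsubC_eq0.
  by rewrite size_mul ?polyXsubC_eq0 // !size_XsubC.
pose w := w0 *m (A - b%:M); pose w' := w *m (A - a%:M).
have w'0 : w' != 0 by rewrite /w' /w -mulmxA.
have w'N : w' *m (A - a%:M) = 0 by rewrite /w' /w -!mulmxA [X in _ *m X]mulmxA NN mulmx0.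
have wN : w *m (A - a%:M) = w' by [].
exists (rows3 [:: w; - d^-1 *: w'; v]).
  apply: rows3_unit => x y z /= E.
  have E1 : x *: w' + z * d *: v = 0.
    have := congr1 (fun u => u *m (A - a%:M)) E.
    by rewrite mul0mx !mulmxDl -!scalemxAl wN w'N vN !scaler0 addr0 scalerA.
  have z0 : z = 0.
    have := congr1 (fun u => u *m (A - a%:M)) E1.
    rewrite mul0mx !mulmxDl -!scalemxAl w'N vN scaler0 add0r scalerA => /eqP.
    by rewrite scaler_eq0 (negbTE v0) orbF !mulf_eq0 (negbTE d0) !orbF => /eqP.
  have x0 : x = 0.
    move/eqP: E1; rewrite z0 mul0r scale0r addr0 scaler_eq0 (negbTE w'0) orbF.
    by move/eqP.
  split=> //; move/eqP: E; rewrite x0 z0 !scale0r add0r addr0 !scaler_eq0.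
  by rewrite (negbTE w'0) oppr_eq0 invr_eq0 (negbTE d0) !orbF => /eqP.
apply: rows3_similar => -[|[|[|]]] //= _.
- by rewrite wN !scale0r add0r addr0 scalerA mulrNN divff // scale1r.
- by rewrite -scalemxAl w'N scaler0 !scale0r !addr0.
- by rewrite vN !scale0r !add0r.
Qed.

(** The basis is w N, - w N^2, w for a cyclic vector w of the nilpotent matrix
    N = A - a E; its order and sign make the residual curve equal to curve4. *)
Lemma normal_form_jordan3 A a :
  char_poly A = ('X - a%:P) ^+ 3 -> mxminpoly A = char_poly A ->
  exists2 S, S \in unitmx & S *m (A - a%:M)
    = mx33 [:: [:: 0; -1; 0]; [:: 0; 0; 0]; [:: 1; 0; 0]] *m S.
Proof.
move=> chA mA; set N := A - a%:M.
have N3 : N *m N *m N = 0.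
  have := Cayley_Hamilton A; rewrite chA rmorphXn /= horner_mx_XsubC => <-.
  by rewrite !exprS expr0 mulr1 -!mulmxE mulmxA.
have [w wN2] : exists w : 'rV_3, w *m (N *m N) != 0.
  apply: nonzero_row; rewrite /N -!horner_mx_XsubC mulmxE -rmorphM /=.
  apply: mxminpoly_full_annihilator => //.
    by rewrite mulf_neq0 // polyXsubC_eq0.
  by rewrite size_mul ?polyXsubC_eq0 // !size_XsubC.
rewrite mulmxA in wN2; pose w1 := w *m N; pose w2 := w1 *m N.
have wN : w *m N = w1 by [].
have w1N : w1 *m N = w2 by [].
have w2N : w2 *m N = 0 by rewrite /w2 /w1 -!mulmxA [N *m (N *m N)]mulmxA N3 mulmx0.
have w20 : w2 != 0 by [].
exists (rows3 [:: w1; - w2; w]).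
  apply: rows3_unit => x y z /= E.
  have E1 : x *: w2 + z *: w1 = 0.
    have := congr1 (fun u => u *m N) E.
    by rewrite mul0mx !mulmxDl -!scalemxAl mulNmx wN w1N w2N oppr0 scaler0 addr0.
  have z0 : z = 0.
    have := congr1 (fun u => u *m N) E1.
    rewrite mul0mx !mulmxDl -!scalemxAl w1N w2N scaler0 add0r => /eqP.
    by rewrite scaler_eq0 (negbTE w20) orbF => /eqP.
  have x0 : x = 0.
    by move/eqP: E1; rewrite z0 scale0r addr0 scaler_eq0 (negbTE w20) orbF => /eqP.
  split=> //; move/eqP: E; rewrite x0 z0 !scale0r add0r addr0 scaler_eq0.
  by rewrite oppr_eq0 (negbTE w20) orbF => /eqP.
apply: rows3_similar => -[|[|[|]]] //= _.
- by rewrite w1N !scale0r add0r addr0 scaleN1r opprK.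
- by rewrite mulNmx w2N oppr0 !scale0r !addr0.
- by rewrite wN !scale0r scale1r !addr0.
Qed.

(** Take for S the last factor of a rank factorization N = L (pid_mx 1) S: then
    S N S^-1 = S L (pid_mx 1) has zeros outside its first column, and its square is
    its corner entry times itself. *)
Lemma normal_form_rank1 (N : 'M[F]_3) d :
  \rank N = 1%N -> N *m N = d *: N ->
  exists S u1 u2, [/\ S \in unitmx, S *m N = mx33 [:: [:: d; 0; 0]; [:: u1; 0; 0]; [:: u2; 0; 0]] *m S
    & (d, u1, u2) != (0, 0, 0)].
Proof.
move=> rN NN; pose S := row_ebase N.
have Su : S \in unitmx := row_ebase_unit N.
pose B := S *m N *m invmx S.
have SN : S *m N = B *m S by rewrite /B mulmxKV.
have BE : B = mx33 [:: [:: B i0 i0; 0; 0]; [:: B i1 i0; 0; 0]; [:: B i2 i0; 0; 0]].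
  have -> : B = S *m col_ebase N *m pid_mx 1.
    by rewrite /B -{1}(mulmx_ebase N) rN !mulmxA mulmxK.
  apply/matrixP => i j; rewrite [RHS]mxE; move: i j; apply: ord3P; apply: ord3P => //=;
  by rewrite mxE sum3E !mxE /= !mulr0 !addr0.
have B0 : B != 0.
  apply/eqP => B0; move/eqP: rN.
  by rewrite -(mulKmx Su N) SN B0 mul0mx mulmx0 mxrank0.
have BB : B *m B = d *: B.
  by rewrite /B !mulmxA mulmxKV // -[S *m N *m N]mulmxA NN -scalemxAr -scalemxAl.
clearbody B.
have B00 : B i0 i0 = d.
  have col0 i : (B i i1 = 0) * (B i i2 = 0).
    by rewrite BE; move: i; apply: ord3P; rewrite !mxE.
  have prod0 i : B i i0 * (B i0 i0 - d) = 0.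
    have := congr1 (fun M : 'M_3 => M i i0) BB; rewrite /= !mxE sum3E !col0 !mul0r !addr0.
    by rewrite mulrBr => ->; rewrite mulrC subrr.
  apply/eqP; rewrite -subr_eq0; apply: contraNT B0 => dB.
  have B_0 i : B i i0 = 0.
    by have /eqP := prod0 i; rewrite mulf_eq0 (negbTE dB) orbF => /eqP.
  by apply/eqP/matrixP => i; apply: ord3P; rewrite ?B_0 ?col0 mxE.
exists S, (B i1 i0), (B i2 i0); split=> //; first by rewrite -B00 -BE.
apply: contraNneq B0 => -[d0 u1 u2]; rewrite BE B00 d0 u1 u2.
apply/eqP/matrixP; apply: ord3P; apply: ord3P; by rewrite !mxE.
Qed.

(** * Pencils of lines *)

Definition rpt (s : seq F) : 'rV[F]_3 := \row_i pt s i.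

Definition passesE := (mevalD, mevalN, mevalZ, mevalXU, mxE).

Lemma not_same_curve (p r : {mpoly F[3]}) (P : 'rV[F]_3) :
  passes_through p P -> ~~ passes_through r P -> ~~ same_curve p r.
Proof.
move=> pP; apply: contra => /existsP[c /andP[c0 /eqP E]].
by move: pP; rewrite /passes_through E mevalZ mulf_eq0 (negbTE c0).
Qed.

Lemma homog1_line (l : {mpoly F[3]}) (P : 'rV[F]_3) :
  l \is 1%N.-homog -> ~~ passes_through l P -> line l.
Proof.
move=> hl lP; rewrite /line /plane_curve hl andbT.
by apply: contraNneq lP => ->; rewrite /passes_through meval0.
Qed.

Lemma coord_line i : line ('X_i : {mpoly F[3]}).
Proof.
apply: (@homog1_line _ (\row_j (j == i)%:R)); first exact: X_homog.
by rewrite /passes_through mevalXU mxE eqxx oner_eq0.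
Qed.

(** For s = enum F these are all the lines over F through (1 : 0 : 0). *)
Definition pencil (s : seq F) : seq {mpoly F[3]} :=
  'X_i2 :: [seq 'X_i1 - c *: 'X_i2 | c <- s].

Lemma pencil_line c : line ('X_i1 - c *: 'X_i2 : {mpoly F[3]}).
Proof.
apply: (@homog1_line _ (rpt [:: 0; 1; 0])).
  by rewrite rpredB ?rpredZ ?X_homog.
by rewrite /passes_through !passesE /pt /= mulr0 subr0 oner_eq0.
Qed.

Lemma pencil_lines s : all (@line F) (pencil s).
Proof.
by rewrite /= coord_line all_map; apply/allP => c _; apply: pencil_line.
Qed.

Lemma pencil_concurrent s : all (fun l => passes_through l (rpt [:: 1; 0; 0])) (pencil s).
Proof.
rewrite /= all_map /passes_through mevalXU mxE /pt /= eqxx /=.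
by apply/allP => c _; rewrite /= /passes_through !passesE /pt /= mulr0 subr0.
Qed.

Lemma distinct_curves_cons l (s : seq {mpoly F[3]}) :
  distinct_curves (l :: s) = all (fun r => ~~ same_curve l r) s && distinct_curves s.
Proof. by []. Qed.

Lemma pencil_line_neq c d : c != d ->
  ~~ same_curve ('X_i1 - c *: 'X_i2 : {mpoly F[3]}) ('X_i1 - d *: 'X_i2).
Proof.
move=> cd; apply: (@not_same_curve _ _ (rpt [:: 0; c; 1])).
  by rewrite /passes_through !passesE /pt /= mulr1 subrr.
by rewrite /passes_through !passesE /pt /= mulr1 subr_eq0.
Qed.

Lemma pencil_distinct s : uniq s -> distinct_curves (pencil s).
Proof.
move=> us; rewrite /distinct_curves /= all_map pairwise_map; apply/andP; split.
  apply/allP => c _ /=; apply: (@not_same_curve _ _ (rpt [:: 0; 1; 0])).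
    by rewrite /passes_through !passesE /pt /=.
  by rewrite /passes_through !passesE /pt /= mulr0 subr0 oner_eq0.
by move: us; rewrite uniq_pairwise; apply: sub_pairwise => c d; apply: pencil_line_neq.
Qed.

Lemma splits_into_prod (p : {mpoly F[3]}) s c :
  (forall r, r \in s -> mirreducible r) -> c != 0 -> p = c *: \prod_(r <- s) r ->
  splits_into p s.
Proof.
by move=> irr c0 E; split=> //; apply/existsP; exists c; rewrite c0 E eqxx.
Qed.

Lemma lines_irreducible (s : seq {mpoly F[3]}) :
  all (@line F) s -> forall r, r \in s -> mirreducible r.
Proof. by move/allP => H r /H /line_irreducible. Qed.

Lemma rank1_pencil_off_center d u1 u2 : d != 0 ->
  let l0 : {mpoly F[3]} := d *: 'X_i0 + u1 *: 'X_i1 + u2 *: 'X_i2 in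
  let s := pencil (enum F) in
  [/\ splits_into (fillF (mx33 [:: [:: d; 0; 0]; [:: u1; 0; 0]; [:: u2; 0; 0]])) (l0 :: s),
      all (@line F) (l0 :: s), distinct_curves (l0 :: s) & ~~ passes_through l0 (rpt [:: 1; 0; 0])].
Proof.
move=> d0 l0 s.
have l0P : ~~ passes_through l0 (rpt [:: 1; 0; 0]).
  by rewrite /passes_through /l0 !passesE /pt /= mulr1 !mulr0 !addr0.
have lines : all (@line F) (l0 :: s).
  rewrite -cat1s all_cat pencil_lines andbT /= andbT; apply: homog1_line l0P.
  by rewrite !rpredD // rpredZ ?X_homog.
split=> //.
- apply: (@splits_into_prod _ _ 1); rewrite ?oner_eq0 //; first exact: lines_irreducible.
  by rewrite scale1r /s /pencil !big_cons big_map fillF_rank1.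
- rewrite distinct_curves_cons pencil_distinct ?enum_uniq // andbT; apply/allP => r r_s.
  apply/negP => /existsP[c /andP[c0 /eqP E]].
  move/negP: l0P; apply; rewrite /passes_through E mevalZ mulf_eq0 orbC.
  by have /allP/(_ r r_s) := pencil_concurrent (enum F); rewrite /passes_through => ->.
Qed.

(** When the corner entry is zero, the linear factor l0 is itself a line through
    (1 : 0 : 0), so it occurs a second time in the pencil. *)
Lemma rank1_pencil_through_center u1 u2 : (u1, u2) != (0, 0) ->
  exists (l0 : {mpoly F[3]}) s,
  [/\ splits_into (fillF (mx33 [:: [:: 0; 0; 0]; [:: u1; 0; 0]; [:: u2; 0; 0]])) (l0 :: l0 :: s),
      all (@line F) (l0 :: s), distinct_curves (l0 :: s), size s = q
    & all (fun l => passes_through l (rpt [:: 1; 0; 0])) (l0 :: s)].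
Proof.
have [-> u0 | u10 _] := eqVneq u1 0.
  have u20 : u2 != 0 by apply: contraNneq u0 => ->.
  exists 'X_i2, [seq 'X_i1 - c *: 'X_i2 | c <- enum F]; split.
  - have lines := lines_irreducible (pencil_lines (enum F)).
    apply: (@splits_into_prod _ _ u2) => // [r|].
      by rewrite inE => /orP[/eqP->|/lines] //; apply: lines; rewrite mem_head.
    rewrite !big_cons big_map fillF_rank1 !scale0r !add0r.
    by rewrite -scalerAl.
  - exact: pencil_lines.
  - exact: pencil_distinct (enum_uniq F).
  - by rewrite size_map -cardE.
  - exact: pencil_concurrent.
pose c0 := - (u2 / u1); pose l0 : {mpoly F[3]} := 'X_i1 - c0 *: 'X_i2.
have l0_line : line l0 := pencil_line c0.
exists l0, (pencil (rem c0 (enum F))); split.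
- apply: (@splits_into_prod _ _ u1) => // [r|].
    rewrite 2!inE orbA orbb => /orP[/eqP->|]; first exact: line_irreducible.
    exact: lines_irreducible (pencil_lines _) r.
  rewrite !big_cons big_map fillF_rank1 scale0r add0r.
  rewrite (perm_big _ (perm_to_rem (mem_enum F c0))) big_cons -/l0.
  have -> : u1 *: 'X_i1 + u2 *: 'X_i2 = u1 *: l0.
    by rewrite /l0 scalerBr scalerA /c0 mulrN mulrCA divff // mulr1 scaleNr opprK.
  by rewrite -scalerAl; congr (_ *: (_ * _)); rewrite mulrCA.
- by rewrite [all _ _]/= l0_line; apply: pencil_lines.
- rewrite distinct_curves_cons pencil_distinct ?rem_uniq ?enum_uniq // andbT.
  rewrite /pencil [all _ _]/= all_map; apply/andP; split.
    apply: (@not_same_curve _ _ (rpt [:: 0; c0; 1])).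
      by rewrite /passes_through !passesE /pt /= mulr1 subrr.
    by rewrite /passes_through !passesE /pt /= oner_eq0.
  apply/allP => c /=; rewrite mem_rem_uniq ?enum_uniq // => /andP[/= cc0 _].
  by apply: pencil_line_neq; rewrite eq_sym.
- by rewrite /= size_map size_rem ?mem_enum // -cardE -card_predK.
- apply/andP; split; last exact: pencil_concurrent.
  by rewrite /passes_through !passesE /pt /= mulr0 subr0.
Qed.

Lemma mxminpoly_split A a b :
  mxminpoly A = ('X - a%:P) * ('X - b%:P) ->
  [/\ (A - a%:M) *m (A - b%:M) = 0, A - a%:M != 0 & A - b%:M != 0].
Proof.
move=> mE; have nz c : A - c%:M != 0.
  rewrite -horner_mx_XsubC -dvd_mxminpoly mE; apply/negP => /dvdp_leq.
  by rewrite polyXsubC_eq0 size_mul ?polyXsubC_eq0 // !size_XsubC => /(_ isT).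
split=> //; rewrite -!horner_mx_XsubC mulmxE -rmorphM -mE; exact: mx_root_minpoly.
Qed.

Lemma mulmx0_rank1 (M N : 'M[F]_3) : M *m N = 0 -> M != 0 -> N != 0 ->
  \rank M = 1%N \/ \rank N = 1%N.
Proof.
move=> /mulmx0_rank_max; rewrite -!mxrank_eq0.
by case: (\rank M) => [|[|m]]; case: (\rank N) => [|[|k]] //; auto; lia.
Qed.

End FillingForm.

(** * The seven cases *)

Section Cases.

Variables (F : finFieldType) (A : 'M[F]_3).

Local Notation i0 := (@Ordinal 3 0 isT).
Local Notation i1 := (@Ordinal 3 1 isT).
Local Notation i2 := (@Ordinal 3 2 isT).

Lemma proj_equiv_lin_subst T (p : {mpoly F[3]}) :
  T \in unitmx -> proj_equiv (lin_subst T p) p.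
Proof. by move=> Tu; exists T; rewrite ?same_curve_refl. Qed.

Lemma lin_subst_line T (l : {mpoly F[3]}) : T \in unitmx -> line l -> line (lin_subst T l).
Proof. exact: lin_subst_plane_curve. Qed.

Lemma case_irreducible_quadratic (a : F) (g : {poly F}) :
  g \is monic -> size g = 3%N -> irreducible_poly g ->
  char_poly A = ('X - a%:P) * g ->
  exists l C : {mpoly F[3]},
    [/\ splits_into (fillF A) [:: l; C], line l, plane_curve #|F|.+1 C & type1 C].
Proof.
move=> g_mon g_sz g_irr chA.
have [S Su SA] := normal_form_nodal g_mon g_sz g_irr chA.
have gE := monic_quadraticE g_mon g_sz.
have g_irr' : irreducible_poly ('X^2 + g`_1 *: 'X + (g`_0)%:P) by rewrite -gE.
have [Cp Ci] := curve1_plane_irreducible a g_irr'.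
have Tu := transport_unit Su; set T := (invmx S)^T in Tu.
exists (lin_subst T 'X_i2), (lin_subst T (curve1 (nodal_mx a g`_0 g`_1))).
have Cp' := lin_subst_plane_curve Tu Cp.
split=> //.
- apply: (splits_into_similar Su SA (s := [:: _; _])).
  apply: (@splits_into_prod _ _ _ 1); rewrite ?oner_eq0 //.
    by move=> r; rewrite !inE => /orP[]/eqP-> //; apply/line_irreducible/coord_line.
  by rewrite !big_cons big_nil mulr1 scale1r fillF_nodal.
- exact: lin_subst_line (coord_line _ _).
split=> //; exists (nodal_mx a g`_0 g`_1); first exact: quad_part_irreducible.
exact: proj_equiv_lin_subst.
Qed.

Lemma case_distinct_eigenvalues (a1 a2 a3 : F) :
  uniq [:: a1; a2; a3] ->
  char_poly A = ('X - a1%:P) * ('X - a2%:P) * ('X - a3%:P) ->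
  exists l1 l2 l3 C : {mpoly F[3]},
    [/\ splits_into (fillF A) [:: l1; l2; l3; C], all (@line F) [:: l1; l2; l3],
        ~ concurrent [:: l1; l2; l3], plane_curve #|F|.-1 C & type2 C].
Proof.
move=> ua chA; have [S Su SA] := normal_form_diag ua chA.
have abc : (a3 - a2) * (a1 - a3) * (a2 - a1) != 0.
  move: ua; rewrite /= !inE negb_or andbT => /andP[/andP[a12 a13] a23].
  by rewrite !mulf_neq0 // subr_eq0 // eq_sym.
have [Cp Ci] := curve2_plane_irreducible abc.
have Tu := transport_unit Su; set T := (invmx S)^T in Tu.
exists (lin_subst T 'X_i0), (lin_subst T 'X_i1), (lin_subst T 'X_i2).
exists (lin_subst T (curve2 (a3 - a2) (a1 - a3) (a2 - a1))).
have Cp' := lin_subst_plane_curve Tu Cp.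
split=> //.
- apply: (splits_into_similar Su SA (s := [:: _; _; _; _])).
  apply: (@splits_into_prod _ _ _ 1); rewrite ?oner_eq0 //.
    move=> r; rewrite !inE => /or4P[]/eqP-> //; exact/line_irreducible/coord_line.
  by rewrite !big_cons big_nil mulr1 scale1r fillF_diag.
- by rewrite /= !lin_subst_line ?coord_line.
- case=> P P0; rewrite /= !lin_subst_passes /passes_through !mevalXU.
  case/and4P => /eqP y0 /eqP y1 /eqP y2 _.
  have : P *m T^T = 0 by apply/rowP; apply: ord3P; rewrite [RHS]mxE.
  move/(congr1 (mulmx^~ (invmx T^T))); rewrite mul0mx mulmxK => [P00|].
    by rewrite P00 eqxx in P0.
  by rewrite unitmx_tr.
split=> //; exists (a3 - a2), (a1 - a3), (a2 - a1); split=> //; first by ring.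
exact: proj_equiv_lin_subst.
Qed.

Lemma case_jordan2 (a b : F) :
  a != b -> char_poly A = ('X - a%:P) ^+ 2 * ('X - b%:P) ->
  mxminpoly A = char_poly A ->
  exists l1 l2 C : {mpoly F[3]},
    [/\ splits_into (fillF A) [:: l1; l2; C], all (@line F) [:: l1; l2],
        distinct_curves [:: l1; l2], plane_curve #|F| C & type3 C].
Proof.
move=> ab chA mA; have [S Su SA] := normal_form_jordan2 ab chA mA.
have Tu := transport_unit Su; set T := (invmx S)^T in Tu.
exists (lin_subst T 'X_i0), (lin_subst T 'X_i2), (lin_subst T (curve3 F)).
have Cp := lin_subst_plane_curve Tu (curve3_plane F).
split=> //.
- apply: (splits_into_similar Su SA (s := [:: _; _; _])).
  apply: (@splits_into_prod _ _ _ (b - a)); rewrite ?subr_eq0 1?eq_sym //.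
    move=> r; rewrite !inE => /or3P[]/eqP->; last exact: curve3_irreducible.
      exact/line_irreducible/coord_line.
    exact/line_irreducible/coord_line.
  by rewrite !big_cons big_nil mulr1 fillF_jordan2.
- by rewrite /= !lin_subst_line ?coord_line.
- apply: (lin_subst_distinct Tu (s := [:: _; _])).
  rewrite /distinct_curves /= !andbT; apply: (@not_same_curve _ _ _ (rpt [:: 0; 0; 1])).
    by rewrite /passes_through !passesE.
  by rewrite /passes_through !passesE /pt /= oner_eq0.
by split=> //; apply: proj_equiv_lin_subst.
Qed.

Lemma case_jordan3 (a : F) :
  char_poly A = ('X - a%:P) ^+ 3 -> mxminpoly A = char_poly A ->
  exists l C : {mpoly F[3]},
    [/\ splits_into (fillF A) [:: l; C], line l, plane_curve #|F|.+1 C & type4 C].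
Proof.
move=> chA mA; have [S Su SA] := normal_form_jordan3 chA mA.
have Tu := transport_unit Su; set T := (invmx S)^T in Tu.
exists (lin_subst T 'X_i2), (lin_subst T (curve4 F)).
have Cp := lin_subst_plane_curve Tu (curve4_plane F).
split=> //.
- apply: (splits_into_similar Su SA (s := [:: _; _])).
  apply: (@splits_into_prod _ _ _ 1); rewrite ?oner_eq0 //.
    move=> r; rewrite !inE => /orP[]/eqP->; last exact: curve4_irreducible.
    exact/line_irreducible/coord_line.
  by rewrite !big_cons big_nil mulr1 scale1r fillF_jordan3.
- exact: lin_subst_line (coord_line _ _).
by split=> //; apply: proj_equiv_lin_subst.
Qed.

Lemma lin_subst_lines T (s : seq {mpoly F[3]}) :
  T \in unitmx -> all (@line F) s -> all (@line F) [seq lin_subst T l | l <- s].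
Proof.
move=> Tu; rewrite all_map; apply: sub_all => l; exact: lin_subst_line.
Qed.

Lemma transport_point_neq0 T (P : 'rV[F]_3) : T \in unitmx -> P != 0 -> P *m invmx T^T != 0.
Proof.
move=> Tu; apply: contra => /eqP E.
have Vu : T^T \in unitmx by rewrite unitmx_tr.
by rewrite -[P](mulmxKV Vu) E mul0mx.
Qed.

Lemma center_neq0 : rpt [:: 1; 0; 0] != 0 :> 'rV[F]_3.
Proof.
by apply/eqP => /rowP/(_ i0)/eqP; rewrite !mxE /pt /= oner_eq0.
Qed.

Lemma size_pencil (s : seq F) : size (pencil s) = (size s).+1.
Proof. by rewrite /= size_map. Qed.

(** The ranks of A - a E and A - b E add up to at most 3, so one of them is 1. The
    square of that matrix is +-(b - a) times itself, hence its pencil of lines has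
    a centre that the remaining line misses. *)
Lemma case_diagonalizable (a b : F) :
  a != b -> mxminpoly A = ('X - a%:P) * ('X - b%:P) ->
  exists (l0 : {mpoly F[3]}) (s : seq {mpoly F[3]}),
    [/\ splits_into (fillF A) (l0 :: s), all (@line F) (l0 :: s),
        distinct_curves (l0 :: s), size s = #|F|.+1
      & exists P : 'rV[F]_3,
          [/\ P != 0, all (fun l => passes_through l P) s & ~~ passes_through l0 P]].
Proof.
move=> ab mA; have [ABz A0 B0] := mxminpoly_split mA.
have [c [d [d0 rc cE]]] : exists c d : F, [/\ d != 0, \rank (A - c%:M) = 1%N
    & (A - c%:M) *m (A - c%:M) = d *: (A - c%:M)].
  have square x y : (A - x%:M) *m (A - y%:M) = 0 ->
      (A - x%:M) *m (A - x%:M) = (y - x) *: (A - x%:M).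
    move=> xy0; have {2}-> : A - x%:M = (A - y%:M) + (y - x)%:M.
      by rewrite raddfB /= addrA subrK.
    by rewrite mulmxDr xy0 add0r mul_mx_scalar.
  have [rA | rB] := mulmx0_rank1 ABz A0 B0.
    by exists a, (b - a); rewrite subr_eq0 eq_sym; split=> //; apply: square.
  exists b, (a - b); rewrite subr_eq0; split=> //; apply: square.
  by rewrite mulrC in mA; case: (mxminpoly_split mA).
have [S [u1 [u2 [Su SA _]]]] := normal_form_rank1 rc cE.
have Tu := transport_unit Su; set T := (invmx S)^T in Tu.
have [spl lines dist l0P] := rank1_pencil_off_center u1 u2 d0.
have Spl := splits_into_similar Su SA spl.
exists (lin_subst T (d *: 'X_i0 + u1 *: 'X_i1 + u2 *: 'X_i2)).
exists [seq lin_subst T l | l <- pencil (enum F)]; split=> //.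
- exact: (lin_subst_lines Tu lines).
- exact: (lin_subst_distinct Tu dist).
- by rewrite size_map size_pencil -cardE.
exists (rpt [:: 1; 0; 0] *m invmx T^T); split.
- exact: transport_point_neq0 Tu center_neq0.
- by rewrite lin_subst_all_pass // pencil_concurrent.
have := lin_subst_all_pass [:: d *: 'X_i0 + u1 *: 'X_i1 + u2 *: 'X_i2] (rpt [:: 1; 0; 0]) Tu.
by rewrite /= !andbT => ->.
Qed.

(** Here A - a E has square zero, hence rank one, and the centre of its pencil of
    lines lies on the remaining line, which is thus double. *)
Lemma case_nilpotent_rank1 (a : F) :
  mxminpoly A = ('X - a%:P) ^+ 2 ->
  exists (l0 : {mpoly F[3]}) (s : seq {mpoly F[3]}),
    [/\ splits_into (fillF A) (l0 :: l0 :: s), all (@line F) (l0 :: s),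
        distinct_curves (l0 :: s), size s = #|F| & concurrent (l0 :: s)].
Proof.
rewrite expr2 => mA; have [N2 N0 _] := mxminpoly_split mA.
have rN : \rank (A - a%:M) = 1%N by case: (mulmx0_rank1 N2 N0 N0).
have NE : (A - a%:M) *m (A - a%:M) = 0 *: (A - a%:M) by rewrite scale0r.
have [S [u1 [u2 [Su SA u0]]]] := normal_form_rank1 rN NE.
have Tu := transport_unit Su; set T := (invmx S)^T in Tu.
have u12 : (u1, u2) != (0, 0) by apply: contraNneq u0 => -[-> ->].
have [l0 [s [spl lines dist sz conc]]] := rank1_pencil_through_center u12.
exists (lin_subst T l0), [seq lin_subst T l | l <- s]; split.
- exact: (splits_into_similar Su SA spl).
- exact: (lin_subst_lines Tu lines).
- exact: (lin_subst_distinct Tu dist).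
- by rewrite size_map.
exists (rpt [:: 1; 0; 0] *m invmx T^T); first exact: transport_point_neq0 Tu center_neq0.
have := lin_subst_all_pass (l0 :: s) (rpt [:: 1; 0; 0]) Tu.
by rewrite conc.
Qed.

Lemma case_scalar (a : F) : mxminpoly A = 'X - a%:P -> fillF A = 0.
Proof.
move=> mA; have := mx_root_minpoly A; rewrite mA horner_mx_XsubC => /eqP.
by rewrite subr_eq0 => /eqP->; apply: fillF_scalar.
Qed.

End Cases.

Theorem theorem4p1 (F : finFieldType) (A : 'M[F]_3)
    (hA : is_scalar_mx A \/ mreducible (fillF A)) :
  (forall (a : F) (g : {poly F}),
      g \is monic -> size g = 3%N -> irreducible_poly g ->
      char_poly A = ('X - a%:P) * g ->
      exists l C : {mpoly F[3]},
        [/\ splits_into (fillF A) [:: l; C],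
            line l,
            plane_curve #|F|.+1 C
          & type1 C])
  /\
  (forall a1 a2 a3 : F,
      uniq [:: a1; a2; a3] ->
      char_poly A = ('X - a1%:P) * ('X - a2%:P) * ('X - a3%:P) ->
      exists l1 l2 l3 C : {mpoly F[3]},
        [/\ splits_into (fillF A) [:: l1; l2; l3; C],
            all (@line F) [:: l1; l2; l3],
            ~ concurrent [:: l1; l2; l3],
            plane_curve #|F|.-1 C
          & type2 C])
  /\
  (forall a b : F,
      a != b ->
      char_poly A = ('X - a%:P) ^+ 2 * ('X - b%:P) ->
      mxminpoly A = char_poly A ->
      exists l1 l2 C : {mpoly F[3]},
        [/\ splits_into (fillF A) [:: l1; l2; C],
            all (@line F) [:: l1; l2],
            distinct_curves [:: l1; l2],
            plane_curve #|F| C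
          & type3 C])
  /\
  (forall a b : F,
      a != b ->
      char_poly A = ('X - a%:P) ^+ 2 * ('X - b%:P) ->
      mxminpoly A = ('X - a%:P) * ('X - b%:P) ->
      exists (l0 : {mpoly F[3]}) (s : seq {mpoly F[3]}),
        [/\ splits_into (fillF A) (l0 :: s),
            all (@line F) (l0 :: s),
            distinct_curves (l0 :: s),
            size s = #|F|.+1
          & exists P : 'rV[F]_3,
              [/\ P != 0,
                  all (fun l => passes_through l P) s
                & ~~ passes_through l0 P]])
  /\
  (forall a : F,
      char_poly A = ('X - a%:P) ^+ 3 ->
      mxminpoly A = char_poly A ->
      exists l C : {mpoly F[3]},
        [/\ splits_into (fillF A) [:: l; C],
            line l,
            plane_curve #|F|.+1 C
          & type4 C])
  /\
  (forall a : F,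
      char_poly A = ('X - a%:P) ^+ 3 ->
      mxminpoly A = ('X - a%:P) ^+ 2 ->
      exists (l0 : {mpoly F[3]}) (s : seq {mpoly F[3]}),
        [/\ splits_into (fillF A) (l0 :: l0 :: s),
            all (@line F) (l0 :: s),
            distinct_curves (l0 :: s),
            size s = #|F|
          & concurrent (l0 :: s)])
  /\
  (forall a : F,
      char_poly A = ('X - a%:P) ^+ 3 ->
      mxminpoly A = 'X - a%:P ->
      fillF A = 0).
Proof.
split; first exact: case_irreducible_quadratic.
split; first exact: case_distinct_eigenvalues.
split; first exact: case_jordan2.
split; first by move=> a b ab _; apply: case_diagonalizable.
split; first exact: case_jordan3.
split; first by move=> a _; apply: case_nilpotent_rank1.
by move=> a _; apply: case_scalar.
Qed.
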